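(* Let $(X,d)$ be a nonempty compact metric space and let $\ell:X\times X\times\mathbb R^2\to\mathbb R$ be continuous and satisfy (l1)–(l4) of the context, with the critical constant of $\ell_0:=\ell(\cdot,\cdot,0,0)$ equal to $0$. Let $u_0:X\to\mathbb R$ be the pointwise supremum $u_0:=\sup_{w\in\mathcal S_0}w$ (which is the uniform limit, as $\lambda\to0^+$, of any family of fixed points $u_\lambda$ of $T_\lambda$). Then for all $x\in X$ $$u_0(x)=\min_{\mu\in\mathfrak M_0}\frac{\int_{X\times X}\big(\partial_u\ell(z,y,0,0)h(z,x)+\partial_v\ell(z,y,0,0)h(y,x)\big)\,d\mu(z,y)}{\int_{X\times X}\Lambda(z,y)\,d\mu(z,y)},$$ where $\mathfrak M_0$ denotes the set of Mather measures of $\ell_0$, $\Lambda(z,y):=\partial_u\ell(z,y,0,0)+\partial_v\ell(z,y,0,0)$, and $h$ is Peierls' barrier of $\ell_0$.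
   Context: Assumptions on $\ell=\ell(z,x,u,v)$: (l1) $\ell$ is $\kappa_u$-Lipschitz in $u$ and $\kappa_v$-Lipschitz in $v$, for constants $\kappa_u,\kappa_v\ge 0$; (l2) $\ell$ is non-increasing in $u$ and in $v$; (l3) $\partial_u\ell(z,x,0,0)$ and $\partial_v\ell(z,x,0,0)$ exist for all $(z,x)$, and for all $(z,x,u,v)$, $|\ell(z,x,u,v)-\ell(z,x,0,0)-\partial_u\ell(z,x,0,0)u-\partial_v\ell(z,x,0,0)v|\le\frac{|u|+|v|}{2}\,\eta\big(\frac{|u|+|v|}{2}\big)$, where $\eta:[0,\infty)\to[0,\infty)$ is a modulus of continuity (nondecreasing, $\eta(0)=0$, continuous at $0$); (l4) $\int_{X\times X}\big(\partial_u\ell(z,x,0,0)+\partial_v\ell(z,x,0,0)\big)d\mu(z,x)<0$ for all Mather measures $\mu$ of $\ell_0$. Critical constant: the unique $c_0\in\mathbb R$ for which there is a continuous $u:X\to\mathbb R$ with $u(x)=\min_{y\in X}\{u(y)+\ell_0(y,x)\}+c_0$ for all $x$; here it is assumed that $c_0=0$. A Mather measure of $\ell_0$ is a Borel probability measure $\mu$ on $X\times X$ whose two marginals on $X$ coincide and with $\int_{X\times X}\ell_0\,d\mu=-c_0=0$. A subsolution of $\ell_0$ is a function $w:X\to\mathbb R$ with $w(y)-w(x)\le\ell_0(x,y)$ for all $x,y\in X$. $\mathcal S_0$ is the set of subsolutions $w$ of $\ell_0$ such that $\int_{X\times X}\big(\partial_u\ell(z,x,0,0)w(z)+\partial_v\ell(z,x,0,0)w(x)\big)d\mu(z,x)\ge0$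 for all Mather measures $\mu$ of $\ell_0$. Peierls' barrier of $\ell_0$ (with $c_0=0$): $h(x,y)=\liminf_{n\to+\infty}h_n(x,y)$, where for $n\ge1$, $h_n(x,y)=\min\big\{\sum_{k=0}^{n-1}\ell_0(x_k,x_{k+1}) : (x_0,\dots,x_n)\in X^{n+1},\ x_0=x,\ x_n=y\big\}$. It is finite valued and continuous on $X\times X$. For $\lambda\in(0,\lambda_0)$, where $\lambda_0\max(\kappa_u,\kappa_v)<1$, and $\varphi\in C^0(X,\mathbb R)$, $T_\lambda\varphi$ is the unique continuous function with $T_\lambda\varphi(x)=\min_{z\in X}\{\varphi(z)+\ell(z,x,\lambda\varphi(z),\lambda T_\lambda\varphi(x))\}$ for all $x\in X$. *)

(* Defs.v *)
From HB Require Import structures.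
From mathcomp Require Import all_boot all_order all_algebra.
From mathcomp Require Import all_classical all_reals all_analysis.
From mathcomp Require Import lra.

Set Implicit Arguments.
Unset Strict Implicit.
Unset Printing Implicit Defensive.

Import Order.TTheory GRing.Theory Num.Theory.
Import numFieldNormedType.Exports.

Local Open Scope classical_set_scope.
Local Open Scope ring_scope.

(* A nonempty metric space. Nonemptiness is carried by a base point, which the
   library requires of every measurable space; no definition below uses it. *)
#[short(type="pmetricType")]
HB.structure Definition PointedMetric (R : numDomainType) :=
  { M of Pointed M & Metric R M }.

Notation borelType T := (g_sigma_algebraType (@open T)).

Definition is_min (R : realType) (S : set R) (m : R) : Prop :=
  S m /\ lbound S m.

(* A modulus of continuity [0, +oo[ -> [0, +oo[; values at negative arguments
   are irrelevant. *)
Definition is_modulus (R : realType) (eta : R -> R) : Prop :=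
  [/\ forall r, 0 <= r -> 0 <= eta r,
      forall r s, 0 <= r -> r <= s -> eta r <= eta s,
      eta 0 = 0
    & eta r @[r --> 0^'+] --> eta 0].

Section cost.
Context (R : realType) (X : pmetricType R).

Section full_cost.
Variable l : X -> X -> R -> R -> R.

Definition cost_continuous : Prop :=
  continuous (fun p : (X * X) * (R * R) => l p.1.1 p.1.2 p.2.1 p.2.2).

Definition du (z x : X) : R := derive1 (fun u : R => l z x u 0) 0.

Definition dv (z x : X) : R := derive1 (fun v : R => l z x 0 v) 0.

Definition cost_lipschitz (ku kv : R) : Prop :=
  (forall z x u u' v, `|l z x u v - l z x u' v| <= ku * `|u - u'|) /\
  (forall z x u v v', `|l z x u v - l z x u v'| <= kv * `|v - v'|).

Definition cost_nonincreasing : Prop :=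
  (forall z x u u' v, u <= u' -> l z x u' v <= l z x u v) /\
  (forall z x u v v', v <= v' -> l z x u v' <= l z x u v).

Definition cost_differentiable (eta : R -> R) : Prop :=
  (forall z x, derivable (fun u : R => l z x u 0) 0 1 /\
               derivable (fun v : R => l z x 0 v) 0 1) /\
  (forall z x u v,
     `|l z x u v - l z x 0 0 - du z x * u - dv z x * v| <=
       (`|u| + `|v|) / 2 * eta ((`|u| + `|v|) / 2)).

End full_cost.

Section reduced_cost.
Variable l0 : X -> X -> R.

Definition critical_constant (c : R) : Prop :=
  exists2 u : X -> R, continuous u &
    forall x, is_min [set u y + l0 y x | y in [set: X]] (u x - c).

Lemma critical_constant_unique (c c' : R) :
  compact [set: X] -> critical_constant c -> critical_constant c' -> c = c'.
Proof.
move=> cX; suff le a b : critical_constant a -> critical_constant b -> a <= b.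
  by move=> Pc Pc'; apply/eqP; rewrite eq_le !le.
move=> [u cu ua] [v cv vb].
have : {within [set: X], continuous (u \- v)}.
  by apply: continuous_subspaceT => x; exact: cvgB (cu x) (cv x).
case/(compact_EVT_min _ cX); first by exists point.
move=> x _ xmin; have [[y _ uy] _] := ua x.
have [_ /(_ (v y + l0 y x))] := vb x.
move=> /(_ (ex_intro2 _ _ y I erefl)) vy.
have := xmin y (in_setT y).
by move: uy vy => /=; lra.
Qed.

(* The definitions below are normalised by a critical constant equal to 0. *)

Definition mather_measure (mu : probability (borelType (X * X)%type) R) : Prop :=
  (forall A : set (borelType X), measurable A ->
     pushforward mu (fst : borelType (X * X)%type -> borelType X) A =
     pushforward mu (snd : borelType (X * X)%type -> borelType X) A) /\
  \int[mu]_p l0 p.1 p.2 = 0.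

Definition subsolution (w : X -> R) : Prop :=
  forall x y, w y - w x <= l0 x y.

(* The infimum is a minimum when [l0] is continuous and [X] compact. *)
Definition chain_cost (n : nat) (x y : X) : R :=
  inf [set \sum_(k < n) l0 (c (inord k)) (c (inord k.+1)) |
        c in [set c : 'I_n.+1 -> X | c ord0 = x /\ c ord_max = y]].

(* [limn_inf] is the usual inferior limit for bounded sequences; when [0] is
   the critical constant, [l0] continuous and [X] compact, the sequence below
   is bounded. The shift restricts it to chains with at least one step. *)
Definition peierls (x y : X) : R :=
  limn_inf (fun n => chain_cost n.+1 x y).

End reduced_cost.

Section selection.
Variable l : X -> X -> R -> R -> R.

Definition cost0 (z x : X) : R := l z x 0 0.

Definition mather_negative : Prop :=
  forall mu : probability (borelType (X * X)%type) R,
    mather_measure cost0 mu -> \int[mu]_p (du l p.1 p.2 + dv l p.1 p.2) < 0.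

(* Subsolutions are not assumed continuous nor measurable: they are continuous
   in restriction to the closed set of points x with peierls x x = 0, which has
   full measure for the marginals of any Mather measure. The integrand is thus
   almost everywhere equal to a measurable function, and the library integral
   of such a function is that of its measurable version. *)
Definition S0 : set (X -> R) :=
  [set w | subsolution cost0 w /\
     forall mu : probability (borelType (X * X)%type) R,
       mather_measure cost0 mu ->
       0 <= \int[mu]_p (du l p.1 p.2 * w p.1 + dv l p.1 p.2 * w p.2)].

Definition u0 (x : X) : R := sup [set w x | w in S0].

Definition mather_ratio (x : X) (mu : probability (borelType (X * X)%type) R) : R :=
  (\int[mu]_p (du l p.1 p.2 * peierls cost0 p.1 x +
               dv l p.1 p.2 * peierls cost0 p.2 x)) /
  (\int[mu]_p (du l p.1 p.2 + dv l p.1 p.2)).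

End selection.

End cost.

(* Main.v *)
(* Let [h] be Peierls' barrier and [S0] the set of admissible subsolutions.
   For [w] in [S0] and a Mather measure [mu], multiplying [w x - w z <= h z x]
   by the nonpositive partial derivatives and integrating bounds [w x] by the
   ratio of [mu]. Conversely, if [a] is at most all ratios at [x], then
   [a - S z], where [S] is the least cost of a chain from [z] to [x], is in [S0]:
   [S] coincides with [h _ x] almost everywhere for the marginals of a Mather
   measure, because the least costs [S_n] of chains with more than [n] steps
   satisfy [S_n <= S_(n+1)] and [S_(n+1) z <= l0 z y + S_n y], which a closed
   measure of zero action saturates. If all ratios at [x] exceeded [u0 x], then
   by compactness of the set of Mather measures some [a > u0 x] would qualify,
   although [a - S] takes the value [a] at [x].
   Mather measures exist and form a compact set because the probability measures
   on [X * X] are weakly compact: a limit along an ultrafilter of integrals is a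
   positive linear functional, represented by a measure by Riesz's theorem. *)
Require Import Defs.
From HB Require Import structures.
From mathcomp Require Import all_boot all_order all_algebra.
From mathcomp Require Import all_classical all_reals all_analysis.
From mathcomp Require Import measurable_realfun lra.
Set Implicit Arguments.
Unset Strict Implicit.
Unset Printing Implicit Defensive.
Import Order.TTheory GRing.Theory Num.Theory.
Import numFieldNormedType.Exports.
Local Open Scope classical_set_scope.
Local Open Scope ring_scope.

(** * Positive functionals and the Riesz representation *)

(** The witness is the distance to the complement of [U] truncated at 1, expressed with balls only:
    [g y] is the supremum of the radii [r <= 1] such that all balls around [y] of radius less than
    [r] lie in [U]. *)
Lemma open_cozero (R : realType) (Y : pseudoMetricType R) (U : set Y) :
  open U -> exists g : Y -> R,
    [/\ continuous g, forall y, 0 <= g y <= 1 & U = [set y | 0 < g y]].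
Proof.
move=> oU; pose S y := [set r : R | 0 <= r <= 1 /\
  forall e z, 0 < e -> e < r -> ball y e z -> U z].
have S0 y : S y 0.
  by split; [lra|move=> e z e0 /(lt_trans e0); rewrite ltxx].
have Sub y : has_ubound (S y) by exists 1 => r [/andP[]].
have hS y : has_sup (S y) by split; [exists 0|].
pose g y := sup (S y).
have g0 y : 0 <= g y by exact: ub_le_sup.
have g1 y : g y <= 1 by apply: ge_sup; [exists 0|move=> r [/andP[]]].
(* [g] is 1-Lipschitz: if [r] is admissible at [y], then [r - d] is admissible at [x] by the
   triangle inequality. *)
have gle x y d : 0 < d -> ball x d y -> g y <= g x + d.
  move=> d0 xy; apply: ge_sup; first by exists 0.
  move=> r [/andP[r0 r1] rU]; have [rd|dr] := leP r d.
    by rewrite (le_trans rd)// lerDr.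
  rewrite -lerBlDr; apply: ub_le_sup => //; split; first lra.
  move=> e z e0 er xz; apply: (rU (d + e)); [lra|lra|].
  exact: ball_triangle (ball_sym xy) xz.
exists g; split => //.
- move=> x; apply/cvgrPdist_le => e e0; near=> y.
  have xy : ball x e y by near: y; exact: nbhsx_ballx.
  by rewrite ler_distlC (gle x y) ?andbT//; rewrite lerBlDr (gle y x)//; exact: ball_sym.
- by move=> y; rewrite g0 g1.
- apply/seteqP; split => y /=.
    move=> Uy; have /nbhs_ballP[e /= e0 eU] := open_nbhs_nbhs (conj oU Uy).
    apply: (@lt_le_trans _ _ (Num.min e 1)); first by rewrite lt_min e0 ltr01.
    apply: ub_le_sup => //; split; first by rewrite le_min ltW//= ler01 ge_min lexx orbT.
    by move=> r z r0; rewrite lt_min => /andP[re _] /(le_ball (ltW re))/eU.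
  move=> /(sup_gt (ex_intro _ 0 (S0 y)))[r [_ rU] r0].
  by apply: (rU (r / 2)); rewrite ?divr_gt0//; [lra|exact/ballxx/divr_gt0].
Unshelve. all: by end_near. Qed.

(* The positive normalised linear functionals on continuous functions; values
   at other functions are irrelevant. *)
Definition mean (R : realType) (Y : topologicalType) (L : (Y -> R) -> R) :=
  [/\ forall f g : Y -> R, continuous f -> continuous g -> L (f \+ g) = L f + L g,
      forall (a : R) (f : Y -> R), continuous f -> L (fun y => a * f y) = a * L f,
      forall f : Y -> R, continuous f -> (forall y, 0 <= f y) -> 0 <= L f
    & L (cst 1) = 1].

Lemma continuous_sumr (R : realType) (Y : topologicalType) (I : Type)
    (r : seq I) (P : pred I) (f : I -> Y -> R) : (forall i, P i -> continuous (f i)) ->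
  continuous (fun y => \sum_(i <- r | P i) f i y).
Proof.
move=> cf; elim: r => [|i r IH] y.
  by under eq_fun do rewrite big_nil; exact: cvg_cst.
under eq_fun do rewrite big_cons.
case: ifPn => [Pi|_]; last exact: IH.
by apply: cvgD; [exact: cf|exact: IH].
Qed.

Section mean_theory.
Context (R : realType) (Y : topologicalType) (L : (Y -> R) -> R).
Hypothesis Lmean : mean L.

Lemma mean_cst a : L (cst a) = a.
Proof.
case: Lmean => _ LZ _ L1; rewrite -[RHS]mulr1 -L1 -LZ; last exact: cst_continuous.
by congr L; apply/funext => y /=; rewrite mulr1.
Qed.

Lemma meanB (f g : Y -> R) : continuous f -> continuous g -> L (f \- g) = L f - L g.
Proof.
case: Lmean => LD LZ _ _ cf cg.
rewrite -mulN1r -LZ// -LD//; last first.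
  by move=> y; apply: cvgM; [exact: cvg_cst|exact: cg].
by congr L; apply/funext => y /=; rewrite mulN1r.
Qed.

Lemma le_mean (f g : Y -> R) : continuous f -> continuous g ->
  (forall y, f y <= g y) -> L f <= L g.
Proof.
case: Lmean => _ _ L0 _ cf cg fg; rewrite -subr_ge0 -meanB//.
apply: L0 => [y|y]; last by rewrite /= subr_ge0.
by apply: cvgB; [exact: cg|exact: cf].
Qed.

Lemma mean_sum n (f : nat -> Y -> R) : (forall i, continuous (f i)) ->
  L (fun y => \sum_(i < n) f i y) = \sum_(i < n) L (f i).
Proof.
case: Lmean => LD LZ _ _ cf; elim: n => [|n IH].
  by rewrite big_ord0 -[RHS]mean_cst; congr L; apply/funext => y; rewrite big_ord0.
rewrite big_ord_recr/= -IH -LD//.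
  by congr L; apply/funext => y; rewrite big_ord_recr.
by apply: continuous_sumr => i _; exact: cf.
Qed.

End mean_theory.

(** The Caratheodory-measurable sets form a sigma-algebra on which [mu] is sigma-additive; once it
    contains the open sets, it contains the Borel sets. *)
Lemma caratheodory_borel_probability (R : realType) (Y : ptopologicalType)
    (mu : {outer_measure set Y -> \bar R}) :
  (forall U, open U -> mu.-caratheodory U) -> mu setT = 1%E ->
  exists P : probability (borelType Y) R, forall A, P A = mu A.
Proof.
move=> oc mu1; pose m (A : set (borelType Y)) := mu A.
have sub : (measurable : set (set (borelType Y))) `<=` mu.-caratheodory.
  apply: smallest_sub => //; split.
  - exact: caratheodory_measurable_set0.
  - by move=> A mA; rewrite setTD; exact: caratheodory_measurable_setC.
  - by move=> A mA; exact: caratheodory_measurable_bigcup.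
have m0 : m set0 = 0%E by exact: outer_measure0.
have mge0 A : (0 <= m A)%E by exact: outer_measure_ge0.
have madd : semi_sigma_additive m.
  move=> A mA tA mbA; apply: (@caratheodory_measure_sigma_additive R Y mu) => //.
  - by move=> i; exact: sub.
  - exact: (sub _ mbA).
pose mm := isMeasure.Build _ _ _ m m0 mge0 madd.
pose m' : {measure set (borelType Y) -> \bar R} := HB.pack m mm.
pose mp := @Measure_isProbability.Build _ (borelType Y) R m' mu1.
pose P : probability (borelType Y) R := HB.pack m mp m'.
by exists P.
Qed.

(** * The outer measure induced by a mean *)

Section riesz.
Context (R : realType) (Y : topologicalType) (L : (Y -> R) -> R).
Hypothesis Lmean : mean L.

(** The sequence [g] stands for its supremum, a lower semicontinuous function that is at least 1 on
    [A]; the last clause says so without naming that supremum, which may be infinite. *)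
Definition majorants (A : set Y) : set R := [set r | exists g : nat -> Y -> R,
  [/\ forall n, continuous (g n), forall n y, 0 <= g n y,
      forall y, nondecreasing_seq (g^~ y), forall n, L (g n) <= r &
      forall y, A y -> forall e, 0 < e -> exists n, 1 - e < g n y]].

Lemma majorants_ge0 A r : majorants A r -> 0 <= r.
Proof.
move=> [g [cg g0 _ Lg _]]; apply: le_trans (Lg 0%N).
by case: Lmean => _ _ + _; exact.
Qed.

Lemma majorantsW A r s : r <= s -> majorants A r -> majorants A s.
Proof.
move=> rs [g [cg g0 ng Lg Ag]]; exists g; split => // n.
exact: le_trans (Lg n) rs.
Qed.

Lemma majorants1 A : majorants A 1.
Proof.
exists (fun=> cst 1); split => //.
- by move=> n; exact: cst_continuous.
- by move=> y m n _ /=.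
- by move=> n; rewrite [leLHS](mean_cst Lmean).
- by move=> y _ e e0; exists 0%N => /=; rewrite gtrBl.
Qed.

Lemma has_inf_majorants A : has_inf (majorants A).
Proof. by split; [exists 1; exact: majorants1|exists 0 => r /majorants_ge0]. Qed.

Definition outer (A : set Y) : \bar R := (inf (majorants A))%:E.

Lemma outer_le A r : majorants A r -> (outer A <= r%:E)%E.
Proof. by move=> Ar; rewrite lee_fin ge_inf//; case: (has_inf_majorants A). Qed.

Lemma outerP A r : (outer A < r%:E)%E -> majorants A r.
Proof.
rewrite lte_fin -subr_gt0 => Ar.
have [s As] := inf_adherent Ar (has_inf_majorants A).
by rewrite addrC subrK => /ltW/majorantsW; apply.
Qed.

Lemma outer_ge0 A : (0 <= outer A)%E.
Proof.
rewrite lee_fin; apply: lb_le_inf; first by case: (has_inf_majorants A).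
by move=> r /majorants_ge0.
Qed.

Lemma le_outer : {homo outer : A B / A `<=` B >-> (A <= B)%E}.
Proof.
move=> A B AB; apply/lee_addgt0Pr => e e0; apply: outer_le.
have : (outer B < outer B + e%:E)%E by rewrite lteDl.
move=> /outerP[g [cg g0 ng Lg Bg]]; exists g; split => // y /AB; exact: Bg.
Qed.

Lemma outer_set0 : outer set0 = 0%E.
Proof.
apply/eqP; rewrite eq_le outer_ge0 andbT; apply: outer_le.
exists (fun=> cst 0); split => //.
- by move=> n; exact: cst_continuous.
- by move=> y m n _ /=.
- by move=> n; rewrite [leLHS](mean_cst Lmean).
Qed.

Lemma outer_sigma_subadditive : sigma_subadditive outer.
Proof.
move=> A; apply/lee_addgt0Pr => e e0.
have o0 n : xpredT n -> (0 <= outer (A n))%E by move=> _; exact: outer_ge0.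
apply: le_trans (epsilon_trick _ (fun n => outer_ge0 (A n)) (ltW e0)).
have d0 i : 0 < e / (2 ^ i.+1)%:R by rewrite divr_gt0// ltr0n expn_gt0.
pose r i := inf (majorants (A i)) + e / (2 ^ i.+1)%:R.
have r0 i : (0 <= (r i)%:E)%E by rewrite EFinD adde_ge0 ?outer_ge0// lee_fin ltW.
rewrite -[X in (_ <= X)%E]/(\sum_(i <oo) (r i)%:E)%E.
(* An infinite series leaves nothing to prove; otherwise its sum is a real [s], to be shown a
   majorant of the union. *)
have [->|] := eqVneq (\sum_(i <oo) (r i)%:E)%E +oo%E; first by rewrite leey.
rewrite -ltey -ge0_fin_numE; last by apply: nneseries_ge0 => ? _ _; exact: r0.
move=> /fineK sE; rewrite -sE; move: sE; set s := fine _ => sE.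
have /choice[g Pg] : forall i, exists g : nat -> Y -> R,
  [/\ forall n, continuous (g n), forall n y, 0 <= g n y,
      forall y, nondecreasing_seq (g^~ y), forall n, L (g n) <= r i &
      forall y, A i y -> forall e, 0 < e -> exists n, 1 - e < g n y].
  by move=> i; apply: outerP; rewrite EFinD lteDl// lte_fin.
(* Diagonal sum: the n-th function adds the n-th terms of the first [n] sequences. It remains
   continuous, is nondecreasing in [n], and its [L] is at most a partial sum of [r], hence at most
   [s]. *)
apply: outer_le; exists (fun n y => \sum_(i < n) g i n y); split.
- by move=> n; apply: continuous_sumr => i _; case: (Pg i).
- by move=> n y; apply: sumr_ge0 => i _; case: (Pg i).
- move=> y m n mn; rewrite -(subnKC mn) big_split_ord/= ler_wpDr//.
    by apply: sumr_ge0 => i _; case: (Pg (m + i)%N).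
  apply: ler_sum => i _; case: (Pg i) => _ _ ng _ _.
  exact: (ng y m _ (leq_addr _ _)).
- move=> n; rewrite (mean_sum Lmean n (f := fun i => g i n)); last first.
    by move=> i; case: (Pg i).
  apply: (@le_trans _ _ (\sum_(i < n) r i)).
    by apply: ler_sum => i _; case: (Pg i).
  rewrite -lee_fin sE -sumEFin; apply: le_trans (nneseries_lim_ge n _).
    by rewrite big_mkord.
  by move=> k *; exact: r0.
- move=> y [i _ Aiy] d dgt0; case: (Pg i) => _ _ ng _ /(_ y Aiy d dgt0)[n ny].
  exists (maxn n i.+1); apply: (lt_le_trans ny).
  have im : (i < maxn n i.+1)%N by rewrite leq_max ltnSn orbT.
  rewrite (bigD1 (Ordinal im))//= ler_wpDr//.
    by apply: sumr_ge0 => j _; case: (Pg j).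
  exact: ng (leq_maxl _ _).
Qed.

(* If [f_n] exhausts [A], then [f_n chi_n] exhausts [A `&` U] and
   [f_n (1 - chi_K)] exhausts [A `\` U], where [chi_n] increases to the
   indicator of [U]; as [L (f_n chi_n)] converges, a large [K] makes the loss
   arbitrarily small. *)
Lemma cozero_caratheodory (h : Y -> R) : continuous h -> (forall y, 0 <= h y) ->
  forall A, (outer (A `&` [set y | (0 < h y)%R]) +
             outer (A `&` ~` [set y | (0 < h y)%R]) <= outer A)%E.
Proof.
move=> ch h0 A; apply/lee_addgt0Pr => e e0.
have e20 : 0 < e / 2 by rewrite divr_gt0.
have : (outer A < outer A + (e / 2)%:E)%E by rewrite lteDl// lte_fin.
move=> /outerP[f [cf f0 nf Lf Af]].
pose chi n y := Num.min (n%:R * h y) 1.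
have cchi n : continuous (chi n).
  move=> y; apply: (@continuous_min _ _ (fun y => n%:R * h y) (cst 1)).
    by apply: cvgM; [exact: cvg_cst|exact: ch].
  exact: cvg_cst.
have chi0 n y : 0 <= chi n y by rewrite le_min mulr_ge0//=.
have chi1 n y : chi n y <= 1 by rewrite ge_min lexx orbT.
have nchi y : nondecreasing_seq (chi^~ y).
  by move=> m n mn; rewrite le_min !ge_min lexx orbT andbT ler_wpM2r ?ler_nat.
have fE (a b : R) : a - a * b = a * (1 - b) by rewrite mulrBr mulr1.
pose fc n y := f n y * chi n y.
have cfc n m : continuous (fun y => f n y * chi m y).
  by move=> y; apply: cvgM; [exact: cf|exact: cchi].
have nfc y : nondecreasing_seq (fc^~ y).
  by move=> m n mn; apply: ler_pM => //; [exact: nf|exact: nchi].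
set r := inf (majorants A) + e / 2 in Lf.
have Lfc n : L (fc n) <= r.
  apply: le_trans (Lf n); apply: le_mean => // [|y]; first exact: cfc.
  by rewrite ler_piMr.
pose S := range (fun n => L (fc n)).
have hS : has_sup S by split; [exists (L (fc 0%N)), 0%N|exists r => _ [n _ <-]].
have [_ [K _ <-] LK] := sup_adherent e20 hS.
have S1 : majorants (A `&` [set y | 0 < h y]) (sup S).
  exists fc; split => //.
  - by move=> n; exact: cfc.
  - by move=> n y; exact: mulr_ge0.
  - by move=> n; apply: ub_le_sup; [case: hS|exists n].
  - move=> y [Ay /= hy] d d0; have [n fn] := Af y Ay d d0.
    pose N := (Num.truncn (h y)^-1).+1.
    have N1 : chi N y = 1.
      apply/eqP; rewrite eq_le chi1 le_min lexx andbT -ler_pdivrMr//.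
      by rewrite mul1r ltW// truncnS_gt.
    exists (maxn n N); apply: (lt_le_trans fn).
    have -> : fc (maxn n N) y = f (maxn n N) y.
      rewrite /fc (_ : chi _ _ = 1) ?mulr1//.
      by apply/eqP; rewrite eq_le chi1 -N1 nchi// leq_maxr.
    exact: nf (leq_maxl _ _).
(* [L (f_n)] is at most [r], and the subtracted part has [L] at least [L (fc K) > sup S - e / 2];
   the index [maxn n K] ensures [f_K <= f_n] for this last bound. *)
have S2 : majorants (A `&` ~` [set y | 0 < h y]) (r - sup S + e / 2).
  exists (fun n y => f (maxn n K) y - f (maxn n K) y * chi K y); split.
  - by move=> n y; apply: cvgB; [exact: cf|exact: cfc].
  - by move=> n y; rewrite subr_ge0 ler_piMr.
  - move=> y m n mn; rewrite !fE; apply: ler_wpM2r; first by rewrite subr_ge0.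
    by apply: nf; rewrite geq_max leq_maxr andbT leq_max mn.
  - move=> n; rewrite meanB//.
    have : L (fc K) <= L (fun y => f (maxn n K) y * chi K y).
      apply: le_mean => // [|y]; first exact: cfc.
      by apply: ler_wpM2r => //; exact: nf (leq_maxr _ _).
    by have := Lf (maxn n K); lra.
  - move=> y [Ay /= /negP]; rewrite -leNgt => hy d d0.
    have [n fn] := Af y Ay d d0; exists n; apply: (lt_le_trans fn).
    rewrite /chi; have -> : h y = 0 by apply/eqP; rewrite eq_le hy h0.
    by rewrite mulr0 min_l// mulr0 subr0; exact: nf (leq_maxl _ _).
apply: le_trans (leeD (outer_le S1) (outer_le S2)) _.
by rewrite -!EFinD lee_fin /r; lra.
Qed.

(* Dini's argument. *)
Lemma mean_le_majorant (A : set Y) (f : Y -> R) r : compact [set: Y] ->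
  continuous f -> (forall y, f y <= \1_A y) -> majorants A r -> L f <= r.
Proof.
move=> /compact_near_coveringP cY cf fA [g [cg g0 ng Lg Ag]].
apply/ler_addgt0Pr => e e0.
have : \forall n \near \oo, [set: Y] `<=` (fun y => f y <= g n y + e).
  apply: (cY nat \oo (fun n y => f y <= g n y + e)) => y _.
  have [n fn] : exists n, f y < g n y + e.
    have := fA y; rewrite indicE; have [/set_mem Ay|_] := boolP (y \in A).
      by move=> f1; have [n gn] := Ag y Ay e e0; exists n; move: f1 gn => /=; lra.
    by move=> f1; exists 0%N; have := g0 0%N y; move: f1 => /=; lra.
  have co : continuous (fun z => g n z + e - f z).
    move=> z; apply: cvgB; last exact: cf.
    by apply: cvgD; [exact: cg|exact: cvg_cst].
  have ny : \forall z \near y, 0 < g n z + e - f z.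
    by apply: (co y (fun x => 0 < x)); apply: open_nbhs_nbhs; split => //=; rewrite subr_gt0.
  exists ([set z | 0 < g n z + e - f z], [set m | (n <= m)%N]) => /=.
    by split => //; exists n.
  move=> [z m] [/= fz nm]; have := ng z n m nm; move: fz => /=; lra.
case=> n _ /(_ n (leqnn n)) fg.
apply: (@le_trans _ _ (L (g n \+ cst e))).
  apply: le_mean => // [y|y]; last exact: fg.
  by apply: cvgD; [exact: cg|exact: cvg_cst].
case: (Lmean) => LD _ _ _; rewrite (LD _ _ (cg n)); last exact: cst_continuous.
by rewrite (mean_cst Lmean); apply: lerD.
Qed.

End riesz.

(** * Bounded measurable functions and their integrals against a probability *)

Definition bounded_measurable d (T : measurableType d) (R : realType) (f : T -> R) :=
  measurable_fun setT f /\ exists M, forall y, `|f y| <= M.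

Section bounded_measurable.
Context d (T : measurableType d) (R : realType).
Implicit Types f g : T -> R.

Lemma bmeas_cst (a : R) : bounded_measurable (cst a : T -> R).
Proof. by split; [exact: measurable_cst|exists `|a|]. Qed.

Lemma bmeasD f g : bounded_measurable f -> bounded_measurable g ->
  bounded_measurable (fun y => f y + g y).
Proof.
move=> [mf [M fM]] [mg [N gN]]; split; first exact: measurable_funD.
by exists (M + N) => y; apply: le_trans (ler_normD _ _) _; apply: lerD.
Qed.

Lemma bmeasM f g : bounded_measurable f -> bounded_measurable g ->
  bounded_measurable (fun y => f y * g y).
Proof.
move=> [mf [M fM]] [mg [N gN]]; split; first exact: measurable_funM.
by exists (M * N) => y; rewrite normrM ler_pM.
Qed.

Lemma bmeasZ (a : R) f : bounded_measurable f ->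
  bounded_measurable (fun y => a * f y).
Proof. by apply: bmeasM; exact: bmeas_cst. Qed.

Lemma bmeasB f g : bounded_measurable f -> bounded_measurable g ->
  bounded_measurable (fun y => f y - g y).
Proof.
move=> bf /(bmeasZ (-1)) bg; have := bmeasD bf bg.
by congr bounded_measurable; apply/funext => y; rewrite mulN1r.
Qed.

Lemma bmeas_indic (A : set T) : measurable A ->
  bounded_measurable (\1_A : T -> R).
Proof.
move=> mA; split; first exact: measurable_indic.
by exists 1 => y; rewrite indicE; case: (_ \in _); rewrite ?normr1 ?normr0.
Qed.

Lemma bmeas_comp d' (T' : measurableType d') (phi : T' -> T) f :
  measurable_fun setT phi -> bounded_measurable f ->
  bounded_measurable (f \o phi).
Proof.
move=> mphi [mf [M fM]]; split; first exact: measurableT_comp.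
by exists M => y; exact: fM.
Qed.

Variable P : probability T R.

Lemma bmeas_integrable f : bounded_measurable f ->
  P.-integrable setT (EFin \o f).
Proof.
move=> [mf [M fM]]; apply: measurable_bounded_integrable => //.
  by rewrite [ltLHS]probability_setT ltry.
by exists M; split; [exact: num_real|move=> x Mx y _; exact: le_trans (fM y) (ltW Mx)].
Qed.

Lemma bmeas_integralD f g : bounded_measurable f -> bounded_measurable g ->
  \int[P]_y (f y + g y) = \int[P]_y f y + \int[P]_y g y.
Proof. by move=> bf bg; rewrite RintegralD//; exact: bmeas_integrable. Qed.

Lemma bmeas_integralB f g : bounded_measurable f -> bounded_measurable g ->
  \int[P]_y (f y - g y) = \int[P]_y f y - \int[P]_y g y.
Proof. by move=> bf bg; rewrite RintegralB//; exact: bmeas_integrable. Qed.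

Lemma bmeas_integralZ a f : bounded_measurable f ->
  \int[P]_y (a * f y) = a * \int[P]_y f y.
Proof. by move=> bf; rewrite RintegralZl//; exact: bmeas_integrable. Qed.

Lemma le_bmeas_integral f g : bounded_measurable f -> bounded_measurable g ->
  (forall y, f y <= g y) -> \int[P]_y f y <= \int[P]_y g y.
Proof. by move=> bf bg fg; apply: le_Rintegral => //; exact: bmeas_integrable. Qed.

Lemma probability_integral_cst a : \int[P]_y a = a :> R.
Proof. by rewrite Rintegral_cst// [X in fine X]probability_setT/= mulr1. Qed.

Lemma probability_integral_indic (A : set T) : measurable A ->
  \int[P]_y (\1_A y) = fine (P A) :> R.
Proof. by move=> mA; rewrite /Rintegral integral_indic// setIT. Qed.

End bounded_measurable.

Lemma continuous_borel_measurable (S T : ptopologicalType) (phi : S -> T) :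
  continuous phi -> measurable_fun setT (phi : borelType S -> borelType T).
Proof.
move=> /continuousP cphi; apply: (@measurability _ _ (borelType S) (borelType T) setT phi (@open T) erefl).
move=> _ [B oB <-]; rewrite setTI; apply: sub_sigma_algebra; exact: cphi.
Qed.

Lemma continuous_bounded_measurable (R : realType) (Y : ptopologicalType) (f : Y -> R) :
  compact [set: Y] -> continuous f -> bounded_measurable (f : borelType Y -> R).
Proof.
move=> cY cf; split.
  apply: (measurability _ (RGenOpens.measurableE R)).
  move=> _ [_ [a [b ->] <-]]; rewrite setTI; apply: sub_sigma_algebra.
  by move/continuousP : cf; apply; exact: interval_open.
have : {within [set: Y], continuous (fun y => `|f y|)}.
  by apply: continuous_subspaceT => y; apply: cvg_norm; exact: cf.
move=> /(compact_EVT_max (ex_intro _ point I) cY)[y _ ymax].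
by exists `|f y| => z; apply: ymax; rewrite in_setT.
Qed.

Lemma mean_integral (R : realType) (Y : ptopologicalType)
    (P : probability (borelType Y) R) : compact [set: Y] ->
  mean (fun f : Y -> R => \int[P]_y f y).
Proof.
move=> cY; split.
- by move=> f g cf cg; apply: bmeas_integralD; exact: continuous_bounded_measurable.
- by move=> a f cf; apply: bmeas_integralZ; exact: continuous_bounded_measurable.
- by move=> f cf f0; exact: Rintegral_ge0.
- exact: probability_integral_cst.
Qed.

(** * Riesz representation of a mean on a compact space *)

Section representation.
Context (R : realType) (Y : ptopologicalType) (L : (Y -> R) -> R).
Hypotheses (Lmean : mean L) (cY : compact [set: Y]).
Hypothesis cozero : forall U : set Y, open U ->
  exists g : Y -> R, [/\ continuous g, forall y, 0 <= g y & U = [set y | 0 < g y]].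

(** Open sets are cozero sets, hence Caratheodory-measurable. The total mass is 1 because the
    constant 1 is a majorising sequence, while [mean_le_majorant] applied to the constant 1 shows
    that no majorant of the whole space is below 1. *)
Lemma outer_probability : exists P : probability (borelType Y) R,
  forall A, P A = outer L A.
Proof.
pose mixin := isOuterMeasure.Build R Y (outer L) (outer_set0 Lmean)
  (outer_ge0 Lmean) (le_outer Lmean) (outer_sigma_subadditive Lmean).
pose mu : {outer_measure set Y -> \bar R} := HB.pack (outer L) mixin.
apply: (@caratheodory_borel_probability R Y mu) => [U oU|].
  apply: le_caratheodory_measurable => A.
  have [g [cg g0 ->]] := cozero oU.
  exact: (cozero_caratheodory Lmean).
apply/eqP; rewrite eq_le; apply/andP; split.
  by apply: (outer_le Lmean); exact: majorants1.
rewrite lee_fin; apply: lb_le_inf; first by exists 1; exact: majorants1.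
move=> r; rewrite -[leLHS](mean_cst Lmean).
apply: (mean_le_majorant Lmean cY); first by move=> y; exact: cvg_cst.
by move=> y; rewrite indicE in_setT.
Qed.

(* Layer cake: [f] is the sum of its slices [min (max (f - i) 0) 1], and [L] of
   the i-th slice is at most the measure of the set where [f > i]. *)
Lemma mean_le_integral1 (P : probability (borelType Y) R) (f : Y -> R) :
  (forall A, P A = outer L A) -> continuous f -> (forall y, 0 <= f y) ->
  L f <= \int[P]_y f y + 1.
Proof.
move=> PL cf f0.
have bf : bounded_measurable (f : borelType Y -> R).
  exact: continuous_bounded_measurable.
pose slice i y := Num.min (Num.max (f y - i%:R) 0) 1.
have cslice i : continuous (slice i).
  move=> y; apply: (@continuous_min _ _ (fun y => Num.max (f y - i%:R) 0) (cst 1)).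
    apply: (@continuous_max _ _ (fun y => f y - i%:R) (cst 0)); last exact: cvg_cst.
    by apply: cvgB; [exact: cf|exact: cvg_cst].
  exact: cvg_cst.
pose A i : set (borelType Y) := [set y | i%:R < f y].
have mA i : measurable (A i).
  apply: sub_sigma_algebra; have /continuousP cf' := cf.
  by have := cf' _ (@open_gt R i%:R); congr open.
(* The slice lies below the indicator of [A i], so its [L] is below every majorant of [A i]. *)
have sliceA i : L (slice i) <= fine (P (A i)).
  rewrite PL; apply: lb_le_inf; first by exists 1; exact: majorants1.
  move=> r; apply: (mean_le_majorant Lmean cY) => // y; rewrite indicE.
  have [/set_mem|/negP] := boolP (y \in A i).
    by rewrite ge_min lexx orbT.
  rewrite inE /A/= => /negP; rewrite -leNgt => fi.
  by rewrite ge_min; apply/orP; left; rewrite ge_max lexx andbT subr_le0.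
have sum_slice n y : \sum_(i < n) slice i y = Num.min (f y) n%:R.
  elim: n => [|n IH]; first by rewrite big_ord0 min_r.
  rewrite big_ord_recr/= IH /slice -natr1.
  have [fn|nf] := leP (f y) n%:R.
    rewrite max_r ?subr_le0// min_l// addr0 min_l//; lra.
  rewrite max_l; last lra.
  have [fn1|n1f] := leP (f y - n%:R) 1; first by rewrite min_l; lra.
  by rewrite min_r; lra.
(* At most [f y + 1] natural numbers are less than [f y]. The second conjunct, bounding the count by
   [n] as long as [n <= f y], carries the induction. *)
have sumA n y : 0 <= f y -> \sum_(i < n) (\1_(A i) y : R) <= f y + 1.
  move=> fy0; suff : \sum_(i < n) (\1_(A i) y : R) <= f y + 1 /\
      (n%:R <= f y -> \sum_(i < n) (\1_(A i) y : R) <= n%:R) by case.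
  elim: n => [|n [IH1 IH2]]; first by rewrite big_ord0; split => //; lra.
  rewrite big_ord_recr/= -natr1 indicE.
  have [/set_mem nf|_] := boolP (y \in A n); last first.
    rewrite /= mulr0n; split => [|h]; first lra.
    have nf : n%:R <= f y by lra.
    by have := IH2 nf; lra.
  by have := IH2 (ltW nf); move: nf; rewrite /A/= mulr1n; split; lra.
have bsum n : bounded_measurable
    (fun y : borelType Y => \sum_(i < n) (\1_(A i) y : R)).
  elim: n => [|n IH].
    by under [X in bounded_measurable X]funext do rewrite big_ord0; exact: bmeas_cst.
  under [X in bounded_measurable X]funext do rewrite big_ord_recr/=.
  by apply: bmeasD => //; exact: bmeas_indic.
have Psum n : \int[P]_y (\sum_(i < n) (\1_(A i) y : R)) = \sum_(i < n) fine (P (A i)).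
  elim: n => [|n IH].
    rewrite big_ord0; under eq_Rintegral do rewrite big_ord0.
    exact: probability_integral_cst.
  rewrite big_ord_recr/= -IH -(probability_integral_indic P (mA n)).
  rewrite -bmeas_integralD//; last exact: bmeas_indic.
  by apply: eq_Rintegral => y _; rewrite big_ord_recr.
have [_ [M fM]] := bf; pose n := (Num.truncn M).+1.
have -> : L f = \sum_(i < n) L (slice i).
  rewrite -(mean_sum Lmean)//; congr L; apply/funext => y.
  rewrite sum_slice min_l// (le_trans (ler_norm _))// (le_trans (fM y))//.
  by rewrite ltW// truncnS_gt.
apply: (@le_trans _ _ (\sum_(i < n) fine (P (A i)))).
  by apply: ler_sum => i _; exact: sliceA.
rewrite -Psum -[X in _ <= _ + X](probability_integral_cst P).
rewrite -bmeas_integralD//; last exact: bmeas_cst.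
apply: le_bmeas_integral => //; first by apply: bmeasD => //; exact: bmeas_cst.
by move=> y; exact: sumA.
Qed.

(** The error 1 of [mean_le_integral1] is removed by homogeneity: applied to [f / e] and multiplied
    by [e], it becomes an arbitrary [e]. Adding a constant lifts the sign condition, and passing to
    [- f] gives the reverse inequality. *)
Theorem riesz_representation : exists P : probability (borelType Y) R,
  forall f : Y -> R, continuous f -> \int[P]_y f y = L f.
Proof.
have [P PL] := outer_probability; exists P.
have Pmean := mean_integral P cY.
case: (Lmean) => LD LZ L0 L1; case: (Pmean) => PD PZ P0 P1.
have cZ (a : R) (f : Y -> R) : continuous f -> continuous (fun y => a * f y).
  by move=> cf y; apply: cvgM; [exact: cvg_cst|exact: cf].
have le0 (f : Y -> R) : continuous f -> (forall y, 0 <= f y) -> L f <= \int[P]_y f y.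
  move=> cf f0; apply/ler_addgt0Pr => e e0.
  pose k : R := e^-1; have k0 : 0 < k by rewrite invr_gt0.
  have kf y : 0 <= k * f y by rewrite mulr_ge0// ltW.
  have := mean_le_integral1 PL (cZ k f cf) kf.
  rewrite LZ// PZ// => h; rewrite -(ler_pM2l k0) mulrDr /k mulVf ?gt_eqF//.
have le (f : Y -> R) : continuous f -> L f <= \int[P]_y f y.
  move=> cf; have [_ [M fM]] := continuous_bounded_measurable cY cf.
  have cM : continuous (cst M : Y -> R) by move=> y; exact: cvg_cst.
  have cfM : continuous (f \+ cst M) by move=> y; apply: cvgD; [exact: cf|exact: cM].
  have := le0 _ cfM; rewrite LD// PD// (mean_cst Lmean) (mean_cst Pmean) lerD2r.
  by apply=> y /=; have := fM y; rewrite ler_norml => /andP[]; lra.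
move=> f cf; apply/eqP; rewrite eq_le le// andbT.
have := le _ (cZ (-1) f cf); rewrite LZ// PZ//; lra.
Qed.

End representation.

(** * Weak compactness and marginals *)

(* Declares the product of two pointed topological spaces as one. *)
HB.saturate prod.

(** The image filter clusters in the compact segment [[- M, M]], and a cluster point of an
    ultrafilter is a limit: no neighbourhood's complement can belong to it. *)
Lemma bounded_ultra_cvg (R : realType) (I : Type) (U : set_system I) (a : I -> R) M :
  UltraFilter U -> (forall i, `|a i| <= M) -> cvg (a i @[i --> U]).
Proof.
move=> UU aM; have UP : ProperFilter U by exact: ultra_proper.
have aP : ProperFilter (a @ U) by exact: fmap_proper_filter.
have [|p [_ clp]] := @segment_compact R (- M) M _ aP.
  suff : U (a @^-1` `[- M, M]) by [].
  by apply: filterE => i /=; rewrite in_itv/= -ler_norml.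
apply/cvg_ex; exists p => B pB.
have [//|aB] := in_ultra_setVsetC (a @^-1` B) UU.
by have [z [/= nBz Bz]] := clp (~` B) B aB pB.
Qed.

Section weak_limits.
Context (R : realType) (Y : ptopologicalType).
Hypothesis cY : compact [set: Y].
Hypothesis cozero : forall U : set Y, open U ->
  exists g : Y -> R, [/\ continuous g, forall y, 0 <= g y & U = [set y | 0 < g y]].

Lemma mean_bounded (L : (Y -> R) -> R) (f : Y -> R) M : mean L ->
  continuous f -> (forall y, `|f y| <= M) -> `|L f| <= M.
Proof.
move=> Lmean cf fM.
have cc (a : R) : continuous (cst a : Y -> R) by move=> y; exact: cvg_cst.
have fM' y : - M <= f y <= M by rewrite -ler_norml.
rewrite ler_norml -[X in X <= _ <= _](mean_cst Lmean) -[X in _ <= _ <= X](mean_cst Lmean).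
by apply/andP; split; apply: (le_mean Lmean) => // y; case/andP: (fM' y).
Qed.

(** Along one ultrafilter finer than [\oo] the bounded sequences [Ls n f] converge for all
    continuous [f] at once, and the axioms of a mean pass to the limit. *)
Lemma weak_compactness (Ls : nat -> (Y -> R) -> R) : (forall n, mean (Ls n)) ->
  exists (P : probability (borelType Y) R) (U : set_system nat),
    [/\ ProperFilter U, U --> \oo &
      forall f : Y -> R, continuous f -> Ls n f @[n --> U] --> \int[P]_y f y].
Proof.
move=> Lm; have [U [UU ooU]] := ultraFilterLemma eventually_filter.
have UP : ProperFilter U by exact: ultra_proper.
pose L f := lim (Ls n f @[n --> U]).
have LsL (f : Y -> R) : continuous f -> Ls n f @[n --> U] --> L f.
  move=> cf; have [_ [M fM]] := continuous_bounded_measurable cY cf.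
  by apply: (@bounded_ultra_cvg _ _ _ _ M) => // n; exact: mean_bounded (Lm n) _ _.
have limE (a : nat -> R) l : a n @[n --> U] --> l -> lim (a n @[n --> U]) = l.
  by move=> al; apply/cvg_lim.
have Lmean : mean L.
  split.
  - move=> f g cf cg; apply: limE.
    under eq_fun => n do (case: (Lm n) => [-> // _ _ _]).
    by apply: cvgD; exact: LsL.
  - move=> a f cf; apply: limE.
    under eq_fun => n do (case: (Lm n) => [_ -> // _ _]).
    by apply: cvgM; [exact: cvg_cst|exact: LsL].
  - move=> f cf f0; apply: limr_ge; first by apply/cvg_ex; exists (L f); exact: LsL.
    by apply: nearW => n; case: (Lm n) => _ _ + _; exact.
  - apply: limE; under eq_fun => n do (case: (Lm n) => [_ _ _ ->]).
    exact: cvg_cst.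
have [P PL] := riesz_representation Lmean cY cozero.
by exists P, U; split => // f cf; rewrite PL//; exact: LsL.
Qed.

End weak_limits.

Section marginals.
Context (R : realType) (Y X : ptopologicalType).
Hypothesis cY : compact [set: Y].
Hypothesis cozero : forall U : set X, open U ->
  exists g : X -> R, [/\ continuous g, forall y, 0 <= g y & U = [set y | 0 < g y]].
Variable P : probability (borelType Y) R.

(** With [U] the set where [g > 0], the continuous function [chi n] lies between the indicators of
    the set where [n * g > 1] and of [U]; these smaller sets increase to [U], so continuity from
    below concludes. *)
Lemma le_open_image (phi psi : Y -> X) : continuous phi -> continuous psi ->
  (forall f : X -> R, continuous f -> \int[P]_y f (phi y) = \int[P]_y f (psi y)) ->
  forall U, open U -> (P (phi @^-1` U) <= P (psi @^-1` U))%E.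
Proof.
move=> cphi cpsi eqI U oU; have [g [cg g0 UE]] := cozero oU.
have mopen (xi : Y -> X) (V : set X) : continuous xi -> open V ->
    measurable (xi @^-1` V : set (borelType Y)).
  by move=> /continuousP cxi oV; apply: sub_sigma_algebra; exact: cxi.
pose A n : set (borelType Y) := phi @^-1` [set x | 1 < n%:R * g x].
pose chi n x := Num.min (n%:R * g x) 1.
have cng n : continuous (fun x => n%:R * g x).
  by move=> x; apply: cvgM; [exact: cvg_cst|exact: cg].
have cchi n : continuous (chi n).
  move=> x; apply: (@continuous_min _ _ (fun x => n%:R * g x) (cst 1)); last exact: cvg_cst.
  exact: cng.
have mA n : measurable (A n).
  apply: mopen => //; have /continuousP := cng n.
  by move=> /(_ _ (@open_gt R 1)).
have AU : \bigcup_n A n = phi @^-1` U.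
  rewrite UE; apply/seteqP; split => y /=.
    move=> [n _]; rewrite /A/= => h; rewrite lt_neqAle g0 andbT eq_sym.
    by apply/eqP => h0; move: h; rewrite h0 mulr0; lra.
  move=> gy; exists (Num.truncn (g (phi y))^-1).+1 => //.
  by rewrite /A/= -ltr_pdivrMr// mul1r truncnS_gt.
have cvA : (P \o A) n @[n --> \oo] --> P (phi @^-1` U).
  rewrite -AU; apply: nondecreasing_cvg_mu => //.
    by rewrite AU; exact: mopen.
  move=> m n mn; apply/subsetPset => y; rewrite /A/= => /lt_le_trans; apply.
  by rewrite ler_wpM2r ?ler_nat.
rewrite -(cvg_lim _ cvA)//; apply: lime_le; first by apply/cvg_ex; eexists; exact: cvA.
have bchi (xi : Y -> X) n : continuous xi ->
    bounded_measurable (chi n \o xi : borelType Y -> R).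
  move=> cxi; apply: continuous_bounded_measurable => //.
  by move=> y; apply: continuous_comp; [exact: cxi|exact: cchi].
have chi0 n x : 0 <= chi n x by rewrite le_min mulr_ge0//=.
have mU : measurable (psi @^-1` U : set (borelType Y)) by exact: mopen.
apply: nearW => n /=; rewrite -[leLHS]fineK ?fin_num_measure//.
rewrite -[leRHS]fineK ?fin_num_measure// lee_fin.
rewrite -!probability_integral_indic//.
apply: (@le_trans _ _ (\int[P]_y chi n (phi y))).
  apply: le_bmeas_integral; [exact: bmeas_indic|exact: bchi|move=> y].
  rewrite indicE; have [/set_mem|_] := boolP (y \in A n); last exact: chi0.
  by rewrite /A/= => /ltW h; rewrite le_min h lexx.
rewrite eqI//; apply: le_bmeas_integral; [exact: bchi|exact: bmeas_indic|move=> y].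
rewrite indicE; have [_|/negP] := boolP (y \in psi @^-1` U).
  by rewrite ge_min lexx orbT.
rewrite inE/= UE/= => /negP; rewrite -leNgt => h.
by rewrite ge_min; apply/orP; left; rewrite mulr_ge0_le0.
Qed.

(** By [le_open_image] in both directions the finite image measures agree on open sets, a class
    stable under intersection that generates the Borel sets. *)
Lemma eq_image_measure (phi psi : Y -> X) : continuous phi -> continuous psi ->
  (forall f : X -> R, continuous f -> \int[P]_y f (phi y) = \int[P]_y f (psi y)) ->
  forall A : set (borelType X), measurable A ->
    pushforward P (phi : borelType Y -> borelType X) A =
    pushforward P (psi : borelType Y -> borelType X) A.
Proof.
move=> cphi cpsi eqI.
have mphi := continuous_borel_measurable cphi.
have mpsi := continuous_borel_measurable cpsi.
unshelve epose (m1 := pushforward P (phi : borelType Y -> borelType X) :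
  {measure set (borelType X) -> \bar R}); first exact: mphi.
unshelve epose (m2 := pushforward P (psi : borelType Y -> borelType X) :
  {measure set (borelType X) -> \bar R}); first exact: mpsi.
have openm : @open X `<=` (measurable : set (set (borelType X))).
  by move=> U oU; exact: sub_sigma_algebra.
have coverT : \bigcup_(k in [set: nat]) (setT : set (borelType X)) = setT.
  by rewrite bigcup_const//; exists 0%N.
have openT' (k : nat) : open [set: X] by exact: openT.
have openI' : setI_closed (@open X) by move=> U V; exact: openI.
have m12 U : open U -> m1 U = m2 U.
  move=> oU; apply/eqP; rewrite eq_le; apply/andP; split.
    exact: le_open_image.
  by apply: le_open_image => // f cf; rewrite eqI.
have m1oo (k : nat) : (m1 setT < +oo)%E.
  by rewrite /m1/= /pushforward preimage_setT [ltLHS]probability_setT ltry.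
move=> A mA.
exact: (@g_sigma_algebra_measure_unique _ R (borelType X) (@open X) openm
  (fun=> setT) openT' coverT m1 m2 openI' m12 m1oo A mA).
Qed.

Lemma image_measure_integral (phi psi : Y -> X) : continuous phi -> continuous psi ->
  (forall A : set (borelType X), measurable A ->
    pushforward P (phi : borelType Y -> borelType X) A =
    pushforward P (psi : borelType Y -> borelType X) A) ->
  forall f : borelType X -> R, bounded_measurable f ->
    \int[P]_y f (phi y) = \int[P]_y f (psi y).
Proof.
move=> cphi cpsi eqP f bf.
have mphi := continuous_borel_measurable cphi.
have mpsi := continuous_borel_measurable cpsi.
have int (xi : borelType Y -> borelType X) : measurable_fun setT xi ->
    P.-integrable (xi @^-1` setT) ((EFin \o f) \o xi).
  by move=> mxi; rewrite preimage_setT; apply: bmeas_integrable; exact: bmeas_comp.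
have mf : measurable_fun setT (EFin \o f) by apply/measurable_EFinP; case: bf.
rewrite /Rintegral; congr fine.
have := integral_pushforward mphi mf (int _ mphi) measurableT.
rewrite preimage_setT => <-.
have := integral_pushforward mpsi mf (int _ mpsi) measurableT.
rewrite preimage_setT => <-.
by apply: eq_measure_integral => A mA _; exact: eqP.
Qed.

End marginals.

(** * Chains and Peierls' barrier *)

Section chains.
Context (R : realType) (X : pmetricType R) (l0 : X -> X -> R).

Definition chain_costs n x y : set R :=
  [set \sum_(k < n) l0 (c (inord k)) (c (inord k.+1)) |
    c in [set c : 'I_n.+1 -> X | c ord0 = x /\ c ord_max = y]].

(** Chains indexed by [nat] can be shifted and prolonged without ordinal casts. *)
Lemma chain_costsP n x y v : chain_costs n x y v <->
  exists C : nat -> X, [/\ C 0%N = x, C n = y &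
    v = \sum_(k < n) l0 (C k) (C k.+1)].
Proof.
split=> [[c [cx cy] <-]|[C [Cx Cy ->]]].
  exists (fun k => c (inord k)); split => //.
  - by rewrite -cx; congr c; apply: val_inj; rewrite /= inordK.
  - by rewrite -cy; congr c; apply: val_inj; rewrite /= inordK.
exists (fun i => C (val i)) => //; apply: eq_bigr => k _ /=.
by rewrite !inordK// ltnS// ltnW.
Qed.

Lemma chain_costs_ge (w : X -> R) n x y v : subsolution l0 w ->
  chain_costs n x y v -> w y - w x <= v.
Proof.
move=> sw /chain_costsP[C [<- <- ->]].
rewrite -(telescope_sumr (fun k => w (C k)) (leq0n n)) big_mkord.
by apply: ler_sum => k _; exact: sw.
Qed.

Lemma chain_costs_neq0 n x y : chain_costs n.+1 x y !=set0.
Proof.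
eexists; apply/chain_costsP; exists (fun k => if k is 0%N then x else y).
by split.
Qed.

Section peierls.
Variables (w : X -> R) (sw : subsolution l0 w).

Lemma has_inf_chain_costs n x y : has_inf (chain_costs n.+1 x y).
Proof.
split; first exact: chain_costs_neq0.
by exists (w y - w x) => v; exact: chain_costs_ge.
Qed.

Lemma chain_cost_le n x y v : chain_costs n.+1 x y v -> chain_cost l0 n.+1 x y <= v.
Proof. by move=> ?; apply: ge_inf => //; case: (has_inf_chain_costs n x y). Qed.

Lemma chain_cost_ge n x y r : (forall v, chain_costs n.+1 x y v -> r <= v) ->
  r <= chain_cost l0 n.+1 x y.
Proof. by move=> h; apply: lb_le_inf => //; exact: chain_costs_neq0. Qed.

Lemma chain_cost_subsolution (w' : X -> R) n x y : subsolution l0 w' ->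
  w' y - w' x <= chain_cost l0 n.+1 x y.
Proof. by move=> sw'; apply: chain_cost_ge => v; exact: chain_costs_ge. Qed.

Lemma chain_cost1 x y : chain_cost l0 1 x y <= l0 x y.
Proof.
apply: chain_cost_le; apply/chain_costsP.
by exists (fun k => if k is 0%N then x else y); rewrite big_ord_recl big_ord0 addr0.
Qed.

Lemma chain_cost_cons n x z y :
  chain_cost l0 n.+2 x y <= l0 x z + chain_cost l0 n.+1 z y.
Proof.
rewrite -lerBlDl; apply: chain_cost_ge => v /chain_costsP[C [Cz Cy ->]].
rewrite lerBlDl; apply: chain_cost_le; apply/chain_costsP.
exists (fun k => if k is k'.+1 then C k' else x); split => //.
by rewrite [RHS]big_ord_recl/= Cz.
Qed.

(** Only the first step of a chain sees its starting point, so the bound is uniform in the length;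
    it is the source of the continuity of the tail costs and of Peierls' barrier. *)
Lemma chain_cost_first n x x' y e : (forall z, l0 x z <= l0 x' z + e) ->
  chain_cost l0 n.+1 x y <= chain_cost l0 n.+1 x' y + e.
Proof.
move=> xx'; rewrite -lerBlDr; apply: chain_cost_ge => v /chain_costsP[C [Cx Cy ->]].
rewrite lerBlDr; apply: (@le_trans _ _
    (l0 x (C 1%N) + \sum_(k < n) l0 (C k.+1) (C k.+2))).
  apply: chain_cost_le; apply/chain_costsP.
  exists (fun k => if k is 0%N then x else C k); split => //.
  by rewrite [RHS]big_ord_recl.
by rewrite big_ord_recl/= Cx addrAC lerD2r.
Qed.

Section bounds.
Variables (M K : R) (s : X -> X).
Hypotheses (l0M : forall x y, l0 x y <= M) (wK : forall x, `|w x| <= K).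
Hypothesis ws : forall x, w x = w (s x) + l0 (s x) x.

(** Along the backward orbit of [y] under [s] every step costs exactly the increment of [w], so
    arbitrarily long chains of bounded cost end at [y]. *)
Lemma calibrated_chain_cost n y :
  chain_cost l0 n.+1 (iter n.+1 s y) y <= w y - w (iter n.+1 s y).
Proof.
elim: n => [|n IH].
  by apply: le_trans (chain_cost1 _ _) _; rewrite /= (ws y); lra.
apply: le_trans (chain_cost_cons _ _ (iter n.+1 s y) _) _.
by move: IH; rewrite [iter n.+2 _ _]iterS; have := ws (iter n.+1 s y); lra.
Qed.

Lemma chain_cost_bounded n x y : `|chain_cost l0 n.+1 x y| <= `|M| + K + K.
Proof.
have ww a b : `|w a - w b| <= K + K by apply: le_trans (ler_normB _ _) _; exact: lerD.
have MM := ler_norm M; have M0 := normr_ge0 M.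
rewrite ler_norml; apply/andP; split.
  have := chain_cost_subsolution n x y sw; have := ww y x.
  by rewrite ler_norml => /andP[]; lra.
case: n => [|n].
  have := chain_cost1 x y; have := l0M x y; have := ww x x.
  by move=> /(le_trans (normr_ge0 _)); lra.
(* Upper bound: one step of cost at most [M] from [x] onto the backward orbit of [y], then along
   this orbit to [y]. *)
have := chain_cost_cons n x (iter n.+1 s y) y.
have := calibrated_chain_cost n y; have := l0M x (iter n.+1 s y).
by have := ww y (iter n.+1 s y); rewrite ler_norml => /andP[]; lra.
Qed.

(** Infimum over all chains with at least [n.+1] steps. *)
Definition tail_cost n x y := infs (fun k => chain_cost l0 k.+1 x y) n.

Let B := `|M| + K + K.

Lemma has_lbound_chain_cost x y : has_lbound (range (fun k => chain_cost l0 k.+1 x y)).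
Proof.
exists (- B) => _ [k _ <-].
by have := chain_cost_bounded k x y; rewrite ler_norml => /andP[].
Qed.

Lemma tail_cost_le n k x y : (n <= k)%N -> tail_cost n x y <= chain_cost l0 k.+1 x y.
Proof.
move=> nk; apply: ge_inf; last by exists k.
have [b bP] := has_lbound_chain_cost x y.
by exists b => _ [j _ <-]; apply: bP; exists j.
Qed.

Lemma tail_cost_ge n x y r :
  (forall k, (n <= k)%N -> r <= chain_cost l0 k.+1 x y) -> r <= tail_cost n x y.
Proof.
move=> h; apply: lb_le_inf; first by exists (chain_cost l0 n.+1 x y), n => /=.
by move=> _ [k /= nk <-]; exact: h.
Qed.

Lemma nondecreasing_tail_cost x y : nondecreasing_seq (fun n => tail_cost n x y).
Proof.
move=> m n mn; apply: tail_cost_ge => k nk.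
by apply: tail_cost_le; exact: leq_trans nk.
Qed.

Lemma tail_cost_cons n x z y : tail_cost n.+1 x y <= l0 x z + tail_cost n z y.
Proof.
rewrite -lerBlDl; apply: tail_cost_ge => k nk; rewrite lerBlDl.
by apply: le_trans (chain_cost_cons _ _ _ _); exact: tail_cost_le.
Qed.

Lemma tail_cost_first n x x' y e : (forall z, l0 x z <= l0 x' z + e) ->
  tail_cost n x y <= tail_cost n x' y + e.
Proof.
move=> xx'; rewrite -lerBlDr; apply: tail_cost_ge => k nk; rewrite lerBlDr.
by apply: le_trans (chain_cost_first _ _ xx'); exact: tail_cost_le.
Qed.

Lemma tail_cost_bounded n x y : `|tail_cost n x y| <= B.
Proof.
rewrite ler_norml; apply/andP; split.
  by apply: tail_cost_ge => k _; have := chain_cost_bounded k x y; rewrite ler_norml => /andP[].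
apply: le_trans (tail_cost_le x y (leqnn n)) _.
by have := chain_cost_bounded n x y; rewrite ler_norml => /andP[].
Qed.

Lemma tail_cost_cvg x y : tail_cost n x y @[n --> \oo] --> peierls l0 x y.
Proof.
(* [limn_inf] is by definition the limit of the sequence [infs], so it suffices that the tail costs
   converge. *)
apply: nondecreasing_is_cvgn; first exact: nondecreasing_tail_cost.
exists B => _ [n _ <-].
by have := tail_cost_bounded n x y; rewrite ler_norml => /andP[].
Qed.

Lemma tail_cost_le_peierls n x y : tail_cost n x y <= peierls l0 x y.
Proof.
apply: nondecreasing_cvgn_le; first exact: nondecreasing_tail_cost.
by apply/cvg_ex; exists (peierls l0 x y); exact: tail_cost_cvg.
Qed.

Lemma peierls_le x y r : (forall n, tail_cost n x y <= r) -> peierls l0 x y <= r.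
Proof.
move=> h; apply: limr_le; last exact: nearW.
by apply/cvg_ex; exists (peierls l0 x y); exact: tail_cost_cvg.
Qed.

Lemma peierls_subsolution (w' : X -> R) x y : subsolution l0 w' ->
  w' y - w' x <= peierls l0 x y.
Proof.
move=> sw'; apply: le_trans (tail_cost_le_peierls 0 x y).
by apply: tail_cost_ge => k _; exact: chain_cost_subsolution.
Qed.

Lemma peierls_first x x' y e : (forall z, l0 x z <= l0 x' z + e) ->
  peierls l0 x y <= peierls l0 x' y + e.
Proof.
move=> xx'; apply: peierls_le => n; apply: le_trans (tail_cost_first n y xx') _.
by rewrite lerD2r tail_cost_le_peierls.
Qed.

Hypotheses (cX : compact [set: X]) (cl0 : continuous (fun p : X * X => l0 p.1 p.2)).

(** Compactness in the second variable makes the neighbourhood of [x] independent of [z]. *)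
Lemma cost_first_near x e : 0 < e ->
  \forall x' \near x, forall z, `|l0 x z - l0 x' z| <= e.
Proof.
move=> e0; have /compact_near_coveringP cX' := cX.
have e20 : 0 < e / 2 by rewrite divr_gt0.
have h z : [set: X] z ->
    \forall z' \near z & x' \near x, `|l0 x z' - l0 x' z'| <= e.
  move=> _; have /cvgrPdist_le /(_ _ e20) := @cl0 (x, z).
  case=> /= -[A A'] /= [xA zA'] AA'; exists (A', A) => //= -[z' x'] /= [Az' Ax'].
  have := AA' (x, z') (conj (nbhs_singleton xA) Az').
  have := AA' (x', z') (conj Ax' Az').
  by rewrite /= !ler_norml => /andP[? ?] /andP[? ?]; apply/andP; split; lra.
apply: filterS (cX' _ (nbhs x) (fun x' z => `|l0 x z - l0 x' z| <= e) _ h).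
by move=> x' Px' z; exact: Px'.
Qed.

Lemma continuous_first (F : X -> R) :
  (forall x x' e, (forall z, l0 x z <= l0 x' z + e) -> F x <= F x' + e) ->
  continuous F.
Proof.
move=> FF x; apply/cvgrPdist_le => e e0.
apply: filterS (cost_first_near x e0) => x' xx'.
rewrite ler_norml; apply/andP; split.
  rewrite lerBrDr addrC lerBlDr; apply: FF => z.
  by have := xx' z; rewrite ler_norml => /andP[]; lra.
rewrite lerBlDl; apply: FF => z.
by have := xx' z; rewrite ler_norml => /andP[]; lra.
Qed.

Lemma continuous_tail_cost n y : continuous (fun x => tail_cost n x y).
Proof. by apply: continuous_first => x x' e; exact: tail_cost_first. Qed.

Lemma continuous_peierls y : continuous (fun x => peierls l0 x y).
Proof. by apply: continuous_first => x x' e; exact: peierls_first. Qed.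

End bounds.
End peierls.
End chains.

(** * Mather measures *)

Lemma cvg_div_n (R : realType) (a : nat -> R) K : (forall n, `|a n| <= K) ->
  n.+1%:R^-1 * a n @[n --> \oo] --> (0 : R).
Proof.
move=> aK; have h : (fun n : nat => K * harmonic n) @ \oo --> (0 : R).
  by rewrite -[0](mulr0 K); apply: cvgM; [exact: cvg_cst|exact: cvg_harmonic].
apply: (@squeeze_cvgr _ _ _ _ (fun n : nat => - (K * harmonic n))
  (fun n : nat => K * harmonic n)).
- apply: nearW => n; rewrite -ler_norml normrM mulrC /harmonic/=.
  by rewrite [X in _ * X <= _]ger0_norm// ler_wpM2r.
- by rewrite -[0]oppr0; exact: cvgN.
- exact: h.
Qed.

Section mather_measures.
Context (R : realType) (X : pmetricType R) (l0 : X -> X -> R).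
Hypotheses (cX : compact [set: X]) (cl0 : continuous (fun p : X * X => l0 p.1 p.2)).

Notation Y := (X * X)%type.
Notation mather := (mather_measure l0).

Lemma compact_square : compact [set: Y].
Proof. by rewrite -setXTT; exact: compact_setX. Qed.

Lemma cozero_of_pseudometric (Z : pseudoMetricType R) (U : set Z) : open U ->
  exists g : Z -> R, [/\ continuous g, forall y, 0 <= g y & U = [set y | 0 < g y]].
Proof.
by move=> /open_cozero[g [cg g01 ->]]; exists g; split => // y; case/andP: (g01 y).
Qed.

Lemma bmeas_fst (f : borelType X -> R) : bounded_measurable f ->
  bounded_measurable (fun p : borelType Y => f p.1).
Proof.
apply: (bmeas_comp (phi := (fst : borelType Y -> borelType X))).
by apply: continuous_borel_measurable => p; exact: cvg_fst.
Qed.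

Lemma bmeas_snd (f : borelType X -> R) : bounded_measurable f ->
  bounded_measurable (fun p : borelType Y => f p.2).
Proof.
apply: (bmeas_comp (phi := (snd : borelType Y -> borelType X))).
by apply: continuous_borel_measurable => p; exact: cvg_snd.
Qed.

Lemma mather_measureP (mu : probability (borelType Y) R) :
  (forall f : X -> R, continuous f -> \int[mu]_p f p.1 = \int[mu]_p f p.2) ->
  \int[mu]_p l0 p.1 p.2 = 0 -> mather mu.
Proof.
move=> fI l0I; split => //.
apply: (eq_image_measure compact_square (@cozero_of_pseudometric X)) => //.
- by move=> p; exact: cvg_fst.
- by move=> p; exact: cvg_snd.
Qed.

Lemma mather_marginals mu (f : borelType X -> R) : mather mu -> bounded_measurable f ->
  \int[mu]_p f p.1 = \int[mu]_p f p.2.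
Proof.
move=> [eqm _]; apply: image_measure_integral => //.
- by move=> p; exact: cvg_fst.
- by move=> p; exact: cvg_snd.
Qed.

Lemma continuous_fst_comp (f : X -> R) : continuous f -> continuous (fun p : Y => f p.1).
Proof. by move=> cf p; apply: continuous_comp; [exact: cvg_fst|exact: cf]. Qed.

Lemma continuous_snd_comp (f : X -> R) : continuous f -> continuous (fun p : Y => f p.2).
Proof. by move=> cf p; apply: continuous_comp; [exact: cvg_snd|exact: cf]. Qed.

(** Closedness and zero action are linear conditions on integrals of continuous functions, so they
    need only hold asymptotically along the sequence. This serves both for the existence of Mather
    measures and for their compactness. *)
Lemma mather_limit (Ls : nat -> (Y -> R) -> R) : (forall n, mean (Ls n)) ->
  (forall f : X -> R, continuous f ->
    Ls n (fun p => f p.1) - Ls n (fun p => f p.2) @[n --> \oo] --> (0 : R)) ->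
  Ls n (fun p => l0 p.1 p.2) @[n --> \oo] --> (0 : R) ->
  exists2 mu, mather mu & exists2 U : set_system nat, ProperFilter U &
    U --> \oo /\
    forall f : Y -> R, continuous f -> Ls n f @[n --> U] --> \int[mu]_p f p.
Proof.
move=> Lm Lf Ll0.
have [mu [U [UP Uoo UL]]] := weak_compactness compact_square
  (@cozero_of_pseudometric Y) Lm.
have toU (a : nat -> R) b : a n @[n --> \oo] --> b -> a n @[n --> U] --> b.
  by move=> ab; apply: cvg_trans ab; apply: cvg_app.
exists mu; last by exists U.
apply: mather_measureP => [f cf|].
  apply/eqP; rewrite -subr_eq0; apply/eqP.
  apply: (@cvg_unique _ (@Rhausdorff R) (Ls n (fun p => f p.1) - Ls n (fun p => f p.2) @[n --> U])).
    by apply: cvgB; apply: UL; [exact: continuous_fst_comp|exact: continuous_snd_comp].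
  exact/toU/Lf.
apply: (@cvg_unique _ (@Rhausdorff R) (Ls n (fun p => l0 p.1 p.2) @[n --> U])).
  exact: UL.
exact: toU.
Qed.

(** A weak limit of a maximising sequence of Mather measures is a Mather measure, by [mather_limit],
    and attains the supremum. *)
Lemma mather_attains (f : Y -> R) mu0 : mather mu0 -> continuous f ->
  exists2 mu, mather mu & forall nu, mather nu -> \int[nu]_p f p <= \int[mu]_p f p.
Proof.
move=> mmu0 cf; pose V := [set \int[nu]_p f p | nu in mather].
have [_ [M fM]] := continuous_bounded_measurable compact_square cf.
have hV : has_sup V.
  split; first by exists (\int[mu0]_p f p), mu0.
  exists M => _ [nu _ <-].
  have := mean_bounded (mean_integral nu compact_square) cf fM.
  exact: le_trans (ler_norm _).
have /choice[nu Pnu] : forall n, exists nu, mather nu /\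
    sup V - n.+1%:R^-1 < \int[nu]_p f p.
  move=> n; have n0 : 0 < n.+1%:R^-1 :> R by rewrite invr_gt0.
  by have [_ [nu ? <-] ?] := sup_adherent n0 hV; exists nu.
have [//|//||mu mmu [U UP [Uoo UL]]] := @mather_limit (fun n g => \int[nu n]_p g p).
- by move=> n; exact: mean_integral compact_square.
- move=> g cg; under eq_fun => n.
    rewrite mather_marginals ?subrr; first over.
      by case: (Pnu n).
    exact: continuous_bounded_measurable.
  exact: cvg_cst.
- by under eq_fun => n do (case: (Pnu n) => [[_ ->] _]); exact: cvg_cst.
exists mu => // xi mxi; apply: (@le_trans _ _ (sup V)).
  by apply: ub_le_sup; [case: hV|exists xi].
have cvgf := UL f cf.
apply/ler_addgt0Pr => e e0; rewrite -lerBlDr.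
rewrite -(cvg_lim (@Rhausdorff R) cvgf).
apply: limr_ge; first by apply/cvg_ex; exists (\int[mu]_p f p).
have : \forall n \near U, n.+1%:R^-1 < e.
  apply: Uoo; have := @cvg_harmonic R; move=> /cvgrPdist_lt/(_ e e0).
  by apply: filterS => n; rewrite sub0r normrN /harmonic/= ger0_norm ?invr_ge0.
apply: filterS => n ne; case: (Pnu n) => _ /ltW; apply: le_trans.
by rewrite lerD2l lerN2 ltW.
Qed.

(* Empirical measures along a backward calibrated orbit are almost closed and
   have almost vanishing action. *)
Lemma mather_exists (w : X -> R) (s : X -> X) : continuous w ->
  (forall x, w x = w (s x) + l0 (s x) x) -> exists mu, mather mu.
Proof.
move=> cw ws; pose x n := iter n s point.
(* The orbit runs backwards, so [x k.+1] is the source of the step and [x k] its target. *)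
pose Ls n (f : Y -> R) := n.+1%:R^-1 * \sum_(k < n.+1) f (x k.+1, x k).
have n0 n : n.+1%:R != 0 :> R by rewrite pnatr_eq0.
have Lm n : mean (Ls n).
  split.
  - by move=> f g _ _; rewrite /Ls -mulrDr -big_split.
  - by move=> a f _; rewrite /Ls -mulr_sumr mulrCA.
  - by move=> f _ f0; rewrite mulr_ge0// sumr_ge0.
  - by rewrite /Ls sumr_const card_ord -mulr_natr mul1r mulVf.
have tele (f : X -> R) n : \sum_(k < n.+1) (f (x k.+1) - f (x k)) = f (x n.+1) - f (x 0%N).
  by rewrite -(telescope_sumr (fun k => f (x k)) (leq0n n.+1)) big_mkord.
have small (f : X -> R) : continuous f ->
    n.+1%:R^-1 * (f (x n.+1) - f (x 0%N)) @[n --> \oo] --> (0 : R).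
  move=> cf; have [_ [M fM]] := continuous_bounded_measurable cX cf.
  apply: (@cvg_div_n _ _ (M + M)) => n.
  by apply: le_trans (ler_normB _ _) _; exact: lerD.
have [//|f cf||mu mmu _] := @mather_limit Ls; last by exists mu.
  under eq_fun do rewrite /Ls -mulrBr -sumrB/= tele.
  exact: small.
(* Calibration turns the action into a telescoping sum of increments of [w]. *)
have l0E n : Ls n (fun p => l0 p.1 p.2) = - (n.+1%:R^-1 * (w (x n.+1) - w (x 0%N))).
  rewrite -mulrN -tele -sumrN; congr (_ * _).
  by apply: eq_bigr => k _; rewrite opprB (ws (x k)) -[s (x k)]/(x k.+1) addrAC subrr add0r.
under eq_fun do rewrite l0E.
by rewrite -[0]oppr0; apply: cvgN; exact: small.
Qed.

(* For a closed measure of zero action, a cocycle inequality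
   [b z <= l0 z y + a y] with [a <= b] is saturated. *)
Lemma mather_squeeze mu (a b : borelType X -> R) : mather mu ->
  bounded_measurable a -> bounded_measurable b -> (forall z, a z <= b z) ->
  (forall z y, b z <= l0 z y + a y) -> \int[mu]_p a p.1 = \int[mu]_p b p.1.
Proof.
move=> mmu ba bb ab bla; apply/eqP; rewrite eq_le; apply/andP; split.
  by apply: le_bmeas_integral; [exact: bmeas_fst|exact: bmeas_fst|].
have bl0 := continuous_bounded_measurable compact_square cl0.
have [_ l0I] := mmu.
rewrite (mather_marginals mmu ba) -[leRHS]add0r -l0I -bmeas_integralD//; last first.
  exact: bmeas_snd.
apply: le_bmeas_integral; [exact: bmeas_fst| |by move=> p; exact: bla].
by apply: bmeasD => //; exact: bmeas_snd.
Qed.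

End mather_measures.

(** * Integrals of bounded functions, and the partial derivatives of the cost *)

Section bounded_integrals.
Context d (T : measurableType d) (R : realType) (P : probability T R).

Lemma ge0_integral_mono (f g : T -> \bar R) : (forall y, 0 <= f y)%E ->
  (forall y, f y <= g y)%E -> (\int[P]_y f y <= \int[P]_y g y)%E.
Proof.
move=> f0 fg; rewrite !ge0_integralTE//; last by move=> y; exact: le_trans (f0 y) (fg y).
by apply: ereal_sup_le => _ [h hf <-]; exists h => // y; exact: le_trans (hf y) (fg y).
Qed.

(* No measurability of [f]: the integral is then a lower integral of the
   positive part minus one of the negative part, and each is monotone. *)
Lemma le_bounded_integral (f g : T -> R) K : (forall y, `|f y| <= K) ->
  bounded_measurable g -> (forall y, f y <= g y) ->
  \int[P]_y f y <= \int[P]_y g y.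
Proof.
move=> fK bg fg; pose F := EFin \o f; pose G := EFin \o g.
have K0 : 0 <= K by apply: le_trans (fK point).
have intK : (\int[P]_y (cst K%:E) y = K%:E)%E.
  by rewrite integral_cst// [X in (_ * X)%E]probability_setT mule1.
have fin (h : T -> \bar R) : (forall y, 0 <= h y)%E -> (forall y, h y <= K%:E)%E ->
    (\int[P]_y h y)%E \is a fin_num.
  move=> h0 hK; rewrite ge0_fin_numE ?integral_ge0//.
  by apply: le_lt_trans (ge0_integral_mono h0 hK) _; rewrite intK ltry.
have Fp : (\int[P]_y F^\+ y)%E \is a fin_num.
  apply: fin => y; first exact: funepos_ge0.
  rewrite funeposE /F/= ge_max !lee_fin K0 andbT.
  exact: le_trans (ler_norm _) (fK y).
have Fn : (\int[P]_y F^\- y)%E \is a fin_num.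
  apply: fin => y; first exact: funeneg_ge0.
  rewrite funenegE /F/= ge_max !lee_fin K0 andbT.
  by apply: le_trans (ler_norm _) _; rewrite normrN.
have Gfin : (\int[P]_y G y)%E \is a fin_num.
  by apply: integrable_fin_num => //; exact: bmeas_integrable.
rewrite /Rintegral fine_le//.
  by rewrite -[X in X \is a _]/(integral P setT F) integralE fin_numB Fp.
rewrite -[leLHS]/(integral P setT F) -[leRHS]/(integral P setT G).
rewrite integralE [leRHS]integralE; apply: leeB; apply: ge0_integral_mono => y //.
  by rewrite !funeposE /F /G/= ge_max le_max lee_fin fg/= le_max lexx orbT.
by rewrite !funenegE /F /G/= ge_max le_max lee_fin lerN2 fg/= le_max lexx orbT.
Qed.

Lemma bounded_cvg_integral (f_ : nat -> T -> R) (f : T -> R) K c :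
  (forall n, measurable_fun setT (f_ n)) -> measurable_fun setT f ->
  (forall n y, `|f_ n y| <= K) -> (forall y, f_ n y @[n --> \oo] --> f y) ->
  (forall n, \int[P]_y f_ n y = c) -> \int[P]_y f y = c.
Proof.
move=> mf_ mf fK ff fc.
have bf n : bounded_measurable (f_ n) by split => //; exists K => y; exact: fK.
have int_cvg : (\int[P]_y (EFin \o f_ n) y)%E @[n --> \oo] --> (\int[P]_y (EFin \o f) y)%E.
  have [|||||_ _ //] := @dominated_convergence _ T R P setT measurableT
    (fun n => EFin \o f_ n) (EFin \o f) (cst K%:E).
  - by move=> n; apply/measurable_EFinP; exact: mf_.
  - exact/measurable_EFinP.
  - by apply: aeW => y _; apply: cvg_EFin; [exact: nearW|exact: ff].
  - exact: bmeas_integrable (bmeas_cst _ K).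
  - by apply: aeW => y n _; rewrite lee_fin.
have int_c n : (\int[P]_y (EFin \o f_ n) y)%E = c%:E.
  rewrite -(fc n) /Rintegral fineK//.
  by apply: integrable_fin_num => //; exact: bmeas_integrable.
suff : (\int[P]_y (EFin \o f) y)%E = c%:E by rewrite /Rintegral => ->.
apply: (cvg_unique (@ereal_hausdorff R) int_cvg).
by rewrite (_ : (fun n => _) = cst c%:E); [exact: cvg_cst|exact/funext].
Qed.

End bounded_integrals.

Lemma continuous_uniform_limit (R : realType) (Y : topologicalType) (f : Y -> R) :
  (forall e, 0 < e -> exists2 g : Y -> R, continuous g & forall y, `|f y - g y| <= e) ->
  continuous f.
Proof.
move=> fg x; apply/cvgrPdist_le => e e0.
have e30 : 0 < e / 3 by rewrite divr_gt0.
have [g cg gf] := fg _ e30; have /cvgrPdist_le/(_ _ e30) := cg x.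
apply: filterS => y; have := gf y; have := gf x.
by rewrite !ler_norml => /andP[? ?] /andP[? ?] /andP[? ?]; apply/andP; split; lra.
Qed.

Section partial_derivatives.
Context (R : realType) (X : pmetricType R) (l : X -> X -> R -> R -> R) (eta : R -> R).
Hypotheses (lc : cost_continuous l) (l2 : cost_nonincreasing l).
Hypotheses (em : is_modulus eta) (l3 : cost_differentiable l eta).

(** (l3) on the two axes bounds the error of the difference quotients uniformly in [z] and [x].
    Continuity of the partial derivatives and their sign are then inherited from these quotients. *)
Lemma partial_approx e : 0 < e -> exists2 t, 0 < t & forall z x,
  `|du l z x - t^-1 * (l z x t 0 - l z x 0 0)| <= e /\
  `|dv l z x - t^-1 * (l z x 0 t - l z x 0 0)| <= e.
Proof.
move=> e0; case: em => eta0 eta_nd eta00 /cvgrPdist_le/(_ _ e0) etae.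
have [r [re r0]] : exists r, eta r <= e /\ 0 < r.
  have near_r : \forall r \near 0^'+, `|eta 0 - eta r| <= e /\ 0 < r.
    by apply: filterS2 etae (nbhs_right_gt 0) => r re r0; split.
  have [r [re r0]] := @filter_ex _ _ (at_right_proper_filter 0) _ near_r.
  exists r; split => //.
  by move: re; rewrite eta00 sub0r normrN; apply: le_trans; exact: ler_norm.
exists r => // z x; case: l3 => _ l3'.
have eta_r2 : r / 2 * eta (r / 2) <= r * e.
  apply: ler_pM; [lra|by apply: eta0; lra|lra|].
  by apply: le_trans re; apply: eta_nd; lra.
have aux (D a b : R) : `|a - b - D * r| <= r * e -> `|D - r^-1 * (a - b)| <= e.
  move=> h; rewrite -(ler_pM2l r0) -[X in X * `|_|](gtr0_norm r0) -normrM mulrBr.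
  by rewrite mulrA mulfV ?gt_eqF// mul1r mulrC distrC.
split; apply: aux.
  have := l3' z x r 0; rewrite normr0 mulr0 addr0 subr0 (gtr0_norm r0).
  by move=> /le_trans; apply.
have := l3' z x 0 r; rewrite normr0 mulr0 add0r subr0 (gtr0_norm r0).
by move=> /le_trans; apply.
Qed.

Lemma continuous_slice a b : continuous (fun p : X * X => l p.1 p.2 a b).
Proof.
move=> p; apply: (@continuous_comp _ _ _ (fun p : X * X => (p, (a, b)))
  (fun p : (X * X) * (R * R) => l p.1.1 p.1.2 p.2.1 p.2.2)); last exact: lc.
exact: (@cvg_pair _ _ _ (nbhs p) (nbhs p) (nbhs (a, b)) _ _ _ id (fun=> (a, b))
  (@cvg_id _ (nbhs p)) (@cvg_cst _ (a, b) _ (nbhs p) _)).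
Qed.

Let continuous_quotient (t a b : R) :
  continuous (fun p : X * X => t^-1 * (l p.1 p.2 a b - l p.1 p.2 0 0)).
Proof.
move=> p; apply: cvgM; first exact: cvg_cst.
by apply: cvgB; exact: continuous_slice.
Qed.

Lemma continuous_du : continuous (fun p : X * X => du l p.1 p.2).
Proof.
apply: continuous_uniform_limit => e /partial_approx[t _ te].
by exists (fun p => t^-1 * (l p.1 p.2 t 0 - l p.1 p.2 0 0)) => // p; case: (te p.1 p.2).
Qed.

Lemma continuous_dv : continuous (fun p : X * X => dv l p.1 p.2).
Proof.
apply: continuous_uniform_limit => e /partial_approx[t _ te].
by exists (fun p => t^-1 * (l p.1 p.2 0 t - l p.1 p.2 0 0)) => // p; case: (te p.1 p.2).
Qed.

Let le0_of_approx (D : R) : (forall e, 0 < e -> exists2 q, q <= 0 & `|D - q| <= e) -> D <= 0.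
Proof.
move=> h; apply/ler_addgt0Pr => e /h[q q0]; rewrite ler_norml => /andP[_]; lra.
Qed.

Lemma du_le0 z x : du l z x <= 0.
Proof.
apply: le0_of_approx => e /partial_approx[t t0 te]; eexists; last exact: (te z x).1.
by rewrite pmulr_rle0 ?invr_gt0// subr_le0; apply: l2.1; exact: ltW.
Qed.

Lemma dv_le0 z x : dv l z x <= 0.
Proof.
apply: le0_of_approx => e /partial_approx[t t0 te]; eexists; last exact: (te z x).2.
by rewrite pmulr_rle0 ?invr_gt0// subr_le0; apply: l2.2; exact: ltW.
Qed.

End partial_derivatives.

(** * The representation formula *)

Section selection.
Context (R : realType) (X : pmetricType R) (l : X -> X -> R -> R -> R) (eta : R -> R).
Hypotheses (cX : compact [set: X]) (lc : cost_continuous l).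
Hypotheses (l2 : cost_nonincreasing l) (em : is_modulus eta).
Hypotheses (l3 : cost_differentiable l eta) (l4 : mather_negative l).
Hypothesis crit : critical_constant (cost0 l) 0.

Notation Y := (X * X)%type.
Notation l0 := (cost0 l).
Notation mather := (mather_measure l0).
Notation h := (peierls l0).
Notation T := (tail_cost l0).

Let cl0 : continuous (fun p : Y => l0 p.1 p.2).
Proof. exact: (@continuous_slice R X l lc 0 0). Qed.

Let cY : compact [set: Y] := compact_square cX.

Let cbm (f : Y -> R) : continuous f -> bounded_measurable (f : borelType Y -> R).
Proof. exact: continuous_bounded_measurable. Qed.

Let bdu : bounded_measurable (fun p : borelType Y => du l p.1 p.2).
Proof. exact/cbm/(continuous_du lc em l3). Qed.

Let bdv : bounded_measurable (fun p : borelType Y => dv l p.1 p.2).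
Proof. exact/cbm/(continuous_dv lc em l3). Qed.

Let calibrated : exists (w : X -> R) (s : X -> X),
  [/\ continuous w, subsolution l0 w & forall x, w x = w (s x) + l0 (s x) x].
Proof.
have [w cw wmin] := crit.
have /choice[s Ps] : forall x, exists y, w x = w y + l0 y x.
  by move=> x; have [[y _ yE] _] := wmin x; exists y; rewrite yE subr0.
exists w, s; split => // x y; have [_ /(_ (w x + l0 x y))] := wmin y.
by rewrite subr0 lerBlDl; apply; exists x.
Qed.

Let l0_bounded : exists M, forall x y, l0 x y <= M.
Proof.
have [_ [M lM]] := cbm cl0; exists M => x y.
exact: le_trans (ler_norm _) (lM (x, y)).
Qed.

(** Properties of the tail costs with the auxiliary calibrated subsolution, its selection [s] and
    the bounds eliminated. *)
Let tail_cost_facts : exists B : R,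
  [/\ forall n x y, `|T n x y| <= B,
      forall n x y, T n x y <= T n.+1 x y,
      forall n x z y, T n.+1 x y <= l0 x z + T n z y,
      forall x y, T 0 x y <= l0 x y /\ 0 <= T 0 y y &
      forall n y, continuous (fun x => T n x y)].
Proof.
have [w [s [cw sw ws]]] := calibrated; have [M lM] := l0_bounded.
have [_ [K wK]] := continuous_bounded_measurable cX cw.
exists (`|M| + K + K); split.
- by move=> n x y; exact: (tail_cost_bounded sw lM wK ws).
- by move=> n x y; exact: (nondecreasing_tail_cost sw lM wK ws).
- by move=> n x z y; exact: (tail_cost_cons sw lM wK ws).
- move=> x y; split.
    apply: le_trans (chain_cost1 sw x y).
    exact: (tail_cost_le sw lM wK ws).
  apply: tail_cost_ge => k _; rewrite -[leLHS](subrr (w y)).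
  exact: chain_cost_subsolution.
- by move=> n y; exact: (continuous_tail_cost sw lM wK ws).
Qed.

Let peierls_facts : exists B : R,
  [/\ forall x y, `|h x y| <= B,
      forall x y, T n x y @[n --> \oo] --> h x y,
      forall n x y, T n x y <= h x y,
      forall w x y, subsolution l0 w -> w y - w x <= h x y &
      forall y, continuous (fun x => h x y)].
Proof.
have [w [s [cw sw ws]]] := calibrated; have [M lM] := l0_bounded.
have [_ [K wK]] := continuous_bounded_measurable cX cw.
have Tle n x y : T n x y <= h x y by exact: (tail_cost_le_peierls sw lM wK ws).
exists (`|M| + K + K); split => //.
- move=> x y; rewrite ler_norml; apply/andP; split.
    apply: le_trans (Tle 0%N x y).
    by have := tail_cost_bounded sw lM wK ws 0%N x y; rewrite ler_norml => /andP[].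
  apply: (peierls_le sw lM wK ws) => n.
  by have := tail_cost_bounded sw lM wK ws n x y; rewrite ler_norml => /andP[].
- by move=> x y; exact: (tail_cost_cvg sw lM wK ws).
- by move=> w' x y; exact: (peierls_subsolution sw lM wK ws).
- by move=> y; exact: (continuous_peierls sw lM wK ws).
Qed.

Let num x (p : Y) := du l p.1 p.2 * h p.1 x + dv l p.1 p.2 * h p.2 x.
Let den (p : Y) := du l p.1 p.2 + dv l p.1 p.2.

Let continuous_den : continuous den.
Proof.
by move=> p; apply: cvgD; [exact: (continuous_du lc em l3)|exact: (continuous_dv lc em l3)].
Qed.

Let continuous_num x : continuous (num x).
Proof.
have [B [_ _ _ _ ch]] := peierls_facts.
move=> p; apply: cvgD; apply: cvgM.
- exact: (continuous_du lc em l3).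
- exact: (continuous_fst_comp (ch x)).
- exact: (continuous_dv lc em l3).
- exact: (continuous_snd_comp (ch x)).
Qed.

Let bden : bounded_measurable (den : borelType Y -> R).
Proof. exact: cbm. Qed.

Let bnum x : bounded_measurable (num x : borelType Y -> R).
Proof. exact: cbm. Qed.

Let num_le_S0 w x mu : S0 l w -> mather mu -> \int[mu]_p num x p <= w x * \int[mu]_p den p.
Proof.
move=> [sw S0w] mmu; have [B [_ _ _ hsub _]] := peierls_facts.
rewrite -bmeas_integralZ// -subr_ge0 -bmeas_integralB//; last exact: bmeasZ.
apply: le_trans (S0w mu mmu) _.
have [M lM] := l0_bounded.
have [_ [D1 duD]] := bdu; have [_ [D2 dvD]] := bdv.
(* A subsolution is bounded: the inequality for the steps from [x] to [z] and from [z] to [x]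
   controls [w z - w x] on both sides. *)
have wB z : `|w z| <= `|w x| + `|M|.
  have := sw x z; have := lM x z; have := sw z x; have := lM z x.
  have := ler_norm M; have := ler_norm (w x); have := ler_norm (- w x).
  by rewrite normrN ler_norml => *; apply/andP; split; lra.
(* The integrand containing [w] is bounded but not known to be measurable; only the dominating one
   is. *)
apply: (@le_bounded_integral _ _ _ _ _ _
  (D1 * (`|w x| + `|M|) + D2 * (`|w x| + `|M|))).
- move=> p; apply: le_trans (ler_normD _ _) _; rewrite !normrM.
  by apply: lerD; apply: ler_pM.
- by apply: bmeasB => //; exact: bmeasZ.
- move=> p; rewrite /num /den.
  have := ler_wnM2l (du_le0 l2 em l3 p.1 p.2) (hsub w p.1 x sw).
  have := ler_wnM2l (dv_le0 l2 em l3 p.1 p.2) (hsub w p.2 x sw).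
  by rewrite !mulrBr; lra.
Qed.

(* [- potential^~ x] is the least subsolution vanishing at [x]. *)
Let potential z x : R := if z == x then 0 else T 0 z x.

Let potential_le z x : potential z x <= T 0 z x.
Proof.
have [B [_ _ _ T0 _]] := tail_cost_facts.
by rewrite /potential; case: eqP => // ->; case: (T0 x x).
Qed.

(** If [y] is [x], the single step from [z] to [x] is a competitor; otherwise a step is prepended to
    a chain. Together with [potential_le] this yields both the subsolution property and the first
    squeeze between [potential] and [T 0]. *)
Let tail_cost_le_potential z y x : T 0 z x <= l0 z y + potential y x.
Proof.
have [B [_ Tnd Tcons T0 _]] := tail_cost_facts; rewrite /potential.
case: eqP => [->|_]; first by rewrite addr0; case: (T0 z x).
exact: le_trans (Tnd _ _ _) (Tcons _ _ _ _).
Qed.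

(** [potential^~ x] may jump at [x], but it is a continuous function times the indicator of the
    complement of a closed point. *)
Let bmeas_potential x : bounded_measurable (fun z : borelType X => potential z x).
Proof.
have [B [_ _ _ _ cT]] := tail_cost_facts.
have mx : measurable (~` [set x] : set (borelType X)).
  apply: sub_sigma_algebra; apply: closed_openC; apply: accessible_closed_set1.
  exact/hausdorff_accessible/metric_hausdorff.
have := bmeasM (continuous_bounded_measurable cX (cT 0%N x)) (bmeas_indic R mx).
congr bounded_measurable; apply/funext => z; rewrite indicE /potential.
have [->|/eqP zx] := eqVneq z x; first by rewrite memNset ?mulr0// => /(_ erefl).
by rewrite mem_set ?mulr1.
Qed.

Let mather_potential mu x : mather mu ->
  \int[mu]_p potential p.1 x = \int[mu]_p h p.1 x.
Proof.
move=> mmu; have [B [TB Tnd Tcons T0 cT]] := tail_cost_facts.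
have [_ [_ Tcvg _ _ ch]] := peierls_facts.
have bT n : bounded_measurable (fun z : borelType X => T n z x).
  exact: (continuous_bounded_measurable cX (cT n x)).
(* In the sequence [potential], [T 0], [T 1], ... each term and its successor satisfy the hypotheses
   of [mather_squeeze]. *)
have TE n : \int[mu]_p T n p.1 x = \int[mu]_p potential p.1 x.
  elim: n => [|n <-]; apply/esym.
    apply: (mather_squeeze cX cl0 mmu (bmeas_potential x) (bT 0%N)) => z.
      exact: potential_le.
    by move=> y; exact: tail_cost_le_potential.
  apply: (mather_squeeze cX cl0 mmu (bT n) (bT n.+1)) => z; first exact: Tnd.
  by move=> y; exact: Tcons.
apply/esym; apply: (@bounded_cvg_integral _ _ _ mu (fun n p => T n p.1 x) _ B) => //.
- by move=> n; case: (bmeas_fst (bT n)).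
- by case: (bmeas_fst (continuous_bounded_measurable cX (ch x))).
Qed.

Let S0_potential a x :
  (forall mu, mather mu -> \int[mu]_p num x p <= a * \int[mu]_p den p) ->
  S0 l (fun z => a - potential z x).
Proof.
move=> numa; split=> [z y|mu mmu].
  have := potential_le z x; have := tail_cost_le_potential z y x; lra.
have [_ [_ _ Th _ ch]] := peierls_facts.
have [_ [D1 duD]] := bdu; have [_ [D2 dvD]] := bdv.
have bh := continuous_bounded_measurable cX (ch x).
have bp := bmeas_potential x.
pose gap z := h z x - potential z x.
have bgap : bounded_measurable (gap : borelType X -> R) by exact: bmeasB.
have gap0 z : 0 <= gap z by rewrite subr_ge0; exact: le_trans (potential_le z x) (Th _ _ _).
have gapI1 : \int[mu]_p gap p.1 = 0.
  have := bmeas_integralB mu (bmeas_fst bh) (bmeas_fst bp).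
  by rewrite mather_potential// subrr.
have gapI2 : \int[mu]_p gap p.2 = 0 by rewrite -(mather_marginals mmu bgap).
have bgap1 := bmeas_fst bgap; have bgap2 := bmeas_snd bgap.
(* Replacing [h] by [potential] in [num] costs at most [D1 * gap p.1 + D2 * gap p.2], whose integral
   vanishes; hence [g] lies below the integrand of the admissibility condition and has a nonnegative
   integral by assumption. *)
pose g p := (a * den p - num x p) - (D1 * gap p.1 + D2 * gap p.2).
have ba : bounded_measurable (fun p : borelType Y => a * den p - num x p).
  by apply: bmeasB => //; exact: bmeasZ.
have bG : bounded_measurable (fun p : borelType Y => D1 * gap p.1 + D2 * gap p.2).
  by apply: bmeasD; exact: bmeasZ.
have g0 : 0 <= \int[mu]_p g p.
  have -> : \int[mu]_p g p = a * \int[mu]_p den p - \int[mu]_p num x p.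
    rewrite (bmeas_integralB mu ba bG) (bmeas_integralB mu (bmeasZ a bden) (bnum x)).
    rewrite (bmeas_integralD mu (bmeasZ D1 bgap1) (bmeasZ D2 bgap2)).
    rewrite (bmeas_integralZ mu a bden) (bmeas_integralZ mu D1 bgap1).
    by rewrite (bmeas_integralZ mu D2 bgap2) gapI1 gapI2 !mulr0 addr0 subr0.
  by rewrite subr_ge0 numa.
apply: le_trans g0 _.
have bw : bounded_measurable (fun z : borelType X => a - potential z x).
  by apply: bmeasB => //; exact: bmeas_cst.
apply: le_bmeas_integral; first exact: bmeasB.
  by apply: bmeasD; apply: bmeasM => //; [exact: (bmeas_fst bw)|exact: (bmeas_snd bw)].
move=> p.
have dug : - D1 * gap p.1 <= du l p.1 p.2 * gap p.1.
  by apply: ler_wpM2r => //; have := duD p; rewrite ler_norml => /andP[].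
have dvg : - D2 * gap p.2 <= dv l p.1 p.2 * gap p.2.
  by apply: ler_wpM2r => //; have := dvD p; rewrite ler_norml => /andP[].
move: dug dvg; rewrite /g /num /den /gap !mulrBr; lra.
Qed.

Let exists_mather : exists mu, mather mu.
Proof.
have [w [s [cw _ ws]]] := calibrated.
exact: (mather_exists cX cl0 cw ws).
Qed.

Lemma S0_neq0 : S0 l !=set0.
Proof.
have [mu0 mmu0] := exists_mather.
have [mu mmu mumax] := mather_attains cX cl0 mmu0 continuous_den.
have d0 := l4 mmu; rewrite -[X in X < 0]/(\int[mu]_p den p) in d0.
have [_ [N numN]] := bnum point.
have N0 : 0 <= N by exact: le_trans (numN point).
(* [mu] maximises the negative integral of [den], so multiplying any other such integral by the
   nonpositive constant [N / \int[mu]_p den p] gives at least [N], which bounds the integral of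
   [num]. *)
exists (fun z => N / (\int[mu]_p den p) - potential z point).
apply: S0_potential => nu mnu; apply: (@le_trans _ _ N).
  apply: le_trans (ler_norm _) _.
  exact: (mean_bounded (mean_integral nu cY) (@continuous_num point)).
rewrite -[leLHS](@divfK _ (\int[mu]_p den p)) ?lt_eqF//.
by apply: ler_wnM2l; [rewrite mulr_ge0_le0// invr_le0 ltW|exact: mumax].
Qed.

Lemma S0_le_ratio w x mu : S0 l w -> mather mu -> w x <= mather_ratio l x mu.
Proof. by move=> Sw mmu; rewrite ler_ndivlMr ?l4//; exact: num_le_S0. Qed.

Lemma has_sup_S0 x : has_sup [set w x | w in S0 l].
Proof.
have [w Sw] := S0_neq0; have [mu mmu] := exists_mather.
split; first by exists (w x), w.
by exists (mather_ratio l x mu) => _ [w' Sw' <-]; exact: S0_le_ratio.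
Qed.

Lemma u0_min_ratio x : is_min [set mather_ratio l x mu | mu in mather] (u0 l x).
Proof.
have u0le mu : mather mu -> u0 l x <= mather_ratio l x mu.
  move=> mmu; apply: ge_sup; first by case: (has_sup_S0 x).
  by move=> _ [w Sw <-]; exact: S0_le_ratio.
split; last by move=> _ [mu mmu <-]; exact: u0le.
have [mu0 mmu0] := exists_mather.
(* As the integral of [den] is negative, a ratio is at most [u0 l x] exactly when the integral of
   this function is nonnegative; maximising it replaces minimising the ratio. *)
have cf : continuous (fun p => num x p - u0 l x * den p).
  move=> p; apply: cvgB; first exact: continuous_num.
  by apply: cvgM; [exact: cvg_cst|exact: continuous_den].
have [mu mmu mumax] := mather_attains cX cl0 mmu0 cf.
have fE (nu : probability (borelType Y) R) : \int[nu]_p (num x p - u0 l x * den p) =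
    \int[nu]_p num x p - u0 l x * \int[nu]_p den p.
  by rewrite (bmeas_integralB nu (bnum x) (bmeasZ _ bden)) (bmeas_integralZ nu _ bden).
have d0 : \int[mu]_p den p < 0 by exact: l4.
exists mu => //; apply/eqP; rewrite eq_le u0le// andbT ler_ndivrMr//.
rewrite leNgt; apply/negP => lt0.
(* Otherwise some [u0 l x + e - potential^~ x] would still be in [S0 l]. *)
have [_ [D denD]] := bden.
have D0 : 0 < D + 1.
  by have := le_trans (normr_ge0 _) (denD point); lra.
pose m := u0 l x * \int[mu]_p den p - \int[mu]_p num x p.
have m0 : 0 < m by rewrite subr_gt0.
(* Raising [u0 l x] by [e] changes its product with the integral of [den] by at most [e * D < m],
   within the margin [m] shared by all Mather measures; the [+ 1] keeps the denominator positive. *)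
pose e := m / (D + 1).
have e0 : 0 < e by rewrite divr_gt0.
have Se : S0 l (fun z => u0 l x + e - potential z x).
  apply: S0_potential => nu mnu.
  have := mumax nu mnu; rewrite !fE => numax.
  have : `|\int[nu]_p den p| <= D.
    exact: (mean_bounded (mean_integral nu cY) continuous_den).
  rewrite ler_norml => /andP[denND _].
  have : e * - (D + 1) <= e * \int[nu]_p den p by rewrite ler_pM2l//; lra.
  rewrite mulrN /e divfK ?gt_eqF// mulrDl /m; lra.
have : u0 l x + e <= u0 l x.
  apply: ub_le_sup; first by case: (has_sup_S0 x).
  by exists (fun z => u0 l x + e - potential z x) => //; rewrite /potential eqxx subr0.
lra.
Qed.

End selection.

Theorem theorem5 (R : realType) (X : pmetricType R)
    (l : X -> X -> R -> R -> R) (ku kv : R) (eta : R -> R)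
    (X_compact : compact [set: X])
    (l_continuous : cost_continuous l)
    (ku_ge0 : 0 <= ku) (kv_ge0 : 0 <= kv)
    (l1 : cost_lipschitz l ku kv)
    (l2 : cost_nonincreasing l)
    (eta_modulus : is_modulus eta)
    (l3 : cost_differentiable l eta)
    (l4 : mather_negative l)
    (c0_eq0 : critical_constant (cost0 l) 0) :
  forall x : X,
    has_sup [set w x | w in S0 l] /\
    is_min [set mather_ratio l x mu | mu in mather_measure (cost0 l)] (u0 l x).
Proof.
move=> x; split.
  exact: (has_sup_S0 X_compact l_continuous l2 eta_modulus l3 l4 c0_eq0).
exact: (u0_min_ratio X_compact l_continuous l2 eta_modulus l3 l4 c0_eq0).
Qed.
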